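(* Let $K\ge1$, let $p\ge1$ be an integer, and let $F$ be a $K$-quasiregular polyharmonic mapping in $\mathbb{D}$ of the form $$F(z)=a_0+\sum_{k=1}^p|z|^{2(k-1)}\sum_{n=1}^\infty\left(a_{n,k}z^n+\overline{b_{n,k}z^n}\right),$$ such that, for every $n\ge1$ and all $k_1,k_2,k_3,k_4\in\{1,\dots,p\}$, all non-zero coefficients $a_{n,k_1},a_{n,k_2}$ and $b_{n,k_3},b_{n,k_4}$ satisfy $$\left|\arg\frac{a_{n,k_1}}{a_{n,k_2}}\right|\le\frac{\pi}{2}\quad\text{and}\quad\left|\arg\frac{b_{n,k_3}}{b_{n,k_4}}\right|\le\frac{\pi}{2}.$$ Suppose $\lambda_F(z)\le\lambda$ for all $z\in\mathbb{D}$, where $\lambda$ is a constant, and $F(0)=0$, $\lambda_F(0)=1$. Then $$|a_{n,k}|+|b_{n,k}|\le\frac{\sqrt{(K^2+1)\lambda^2-1}}{n}\quad\text{for all } n\ge2,\ k=1,$$ $$|a_{n,k}|+|b_{n,k}|\le\frac{\sqrt{(K^2+1)\lambda^2-1}}{\sqrt{10}}\quad\text{for all } n\ge2,\ 2\le k\le p,$$ $$|a_{n,k}|+|b_{n,k}|\le\frac{\sqrt{(K^2+1)\lambda^2-1}}{\sqrt{5}}\quad\text{for } n=1,\ 2\le k\le p.$$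
   Context: $\mathbb{D}=\{z\in\mathbb{C}:|z|<1\}$. For a continuously differentiable complex-valued $f$ put $\Lambda_f(z)=|f_z(z)|+|f_{\bar z}(z)|$, $\lambda_f(z)=\big||f_z(z)|-|f_{\bar z}(z)|\big|$, $J_f(z)=|f_z(z)|^2-|f_{\bar z}(z)|^2$. A $2p$-times continuously differentiable complex-valued $F$ is polyharmonic if $\Delta^pF=0$, where $\Delta=4\partial^2/\partial z\partial\bar z$. In $\mathbb{D}$ this is equivalent to $F(z)=\sum_{k=1}^p|z|^{2(k-1)}G_{p-k+1}(z)$ with all $G_{p-k+1}$ complex-valued harmonic in $\mathbb{D}$. In the series representation in the claim, for each $k$ the functions $\sum_{n\ge1}a_{n,k}z^n$ and $\sum_{n\ge1}b_{n,k}z^n$ are analytic in $\mathbb{D}$. A $K$-quasiregular mapping ($K\ge1$) is a sense-preserving continuous mapping $f:\mathbb{D}\to\mathbb{C}$ that is $ACL^2$ (absolutely continuous on almost every horizontal and vertical line in each closed rectangle in $\mathbb{D}$ with sides parallel to the axes, with locally $L^2$ partial derivatives), with $J_f\ne0$ a.e. and $\Lambda_f^2\le KJ_f$ a.e. in $\mathbb{D}$. (For a continuously differentiable $f$, which is automatically $ACL^2$, sense-preserving is taken to mean $J_f\ge0$, so that $J_f>0$ a.e.; the inequality is then equivalent to $\Lambda_f\le K\lambda_f$.) $\arg$ denotes the principal argument, in $(-\pi,\pi]$. *)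

(* Defs.v *)
From HB Require Import structures.
From mathcomp Require Import all_boot all_order all_algebra.
From mathcomp Require Import all_classical all_reals all_analysis.
From mathcomp Require Import complex.
Set Implicit Arguments.
Unset Strict Implicit.
Unset Printing Implicit Defensive.
Import Order.TTheory GRing.Theory Num.Theory.
Import numFieldNormedType.Exports.
Local Open Scope classical_set_scope.
Local Open Scope ring_scope.
Local Open Scope complex_scope.

(* Functions on the unit disk are total functions on R[i]; every notion below
   only depends on their values on the (open) disk. *)

(* R[i] with the topology of its norm, as numFieldNormedType gives to abstract
   numFieldTypes. *)
HB.instance Definition _ (R : realType) := PseudoPointedMetric.copy R[i] R[i]^o.
HB.instance Definition _ (R : realType) := GRing.ComAlgebra.copy R[i] R[i]^o.
HB.instance Definition _ (R : realType) := Vector.copy R[i] R[i]^o.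
HB.instance Definition _ (R : realType) := NormedModule.copy R[i] R[i]^o.

Notation cmod := Normc.normc.

Section complex_plane.
Context {R : realType}.
Implicit Types (z : R[i]) (f : R[i] -> R[i]) (g : R -> R[i]).

Definition disk : set R[i] := [set z | cmod z < 1].

Definition toC (w : R * R) : R[i] := w.1 +i* w.2.

(* In ]-pi, pi] for z != 0; the value at 0 is irrelevant. *)
Definition Arg z : R :=
  let t := acos (complex.Re z / cmod z) in
  if 0 <= complex.Im z then t else - t.

Definition derivableC g (t : R) : Prop :=
  derivable (fun s => complex.Re (g s)) t 1 /\
  derivable (fun s => complex.Im (g s)) t 1.

Definition deriveC g (t : R) : R[i] :=
  derive1 (fun s => complex.Re (g s)) t +i*
  derive1 (fun s => complex.Im (g s)) t.

Definition hslice f (y : R) : R -> R[i] := fun x => f (x +i* y).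
Definition vslice f (x : R) : R -> R[i] := fun y => f (x +i* y).

Definition dx f : R[i] -> R[i] :=
  fun z => deriveC (hslice f (complex.Im z)) (complex.Re z).
Definition dy f : R[i] -> R[i] :=
  fun z => deriveC (vslice f (complex.Re z)) (complex.Im z).

Definition dz f : R[i] -> R[i] := fun z => (dx f z - (0 +i* 1) * dy f z) / 2%:R.
Definition dzbar f : R[i] -> R[i] :=
  fun z => (dx f z + (0 +i* 1) * dy f z) / 2%:R.

Definition Lambda_ f z : R := cmod (dz f z) + cmod (dzbar f z).
Definition lambda_ f z : R := `| cmod (dz f z) - cmod (dzbar f z) |.
Definition Jacobian f z : R := cmod (dz f z) ^+ 2 - cmod (dzbar f z) ^+ 2.

Definition laplacian f : R[i] -> R[i] := fun z => 4%:R * dz (dzbar f) z.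

Definition continuous_disk f : Prop :=
  forall z, disk z -> {for z, continuous f}.

(* f is n times continuously differentiable in the disk. *)
Fixpoint Cn_disk (n : nat) f : Prop :=
  match n with
  | 0%N => continuous_disk f
  | m.+1 => [/\ continuous_disk f,
      forall z, disk z -> derivableC (hslice f (complex.Im z)) (complex.Re z),
      forall z, disk z -> derivableC (vslice f (complex.Re z)) (complex.Im z),
      Cn_disk m (dx f) & Cn_disk m (dy f)]
  end.

Definition polyharmonic (p : nat) f : Prop :=
  Cn_disk (2 * p) f /\ forall z, disk z -> iter p laplacian f z = 0.

Definition abs_continuous (a b : R) g : Prop :=
  forall e : R, 0 < e -> exists2 d : R, 0 < d &
    forall (n : nat) (s t : 'I_n -> R),
      (forall i, [/\ a <= s i, s i <= t i & t i <= b]) ->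
      (forall i j, i != j -> t i <= s j \/ t j <= s i) ->
      \sum_(i < n) (t i - s i) < d ->
      \sum_(i < n) cmod (g (t i) - g (s i)) < e.

Definition lebesgue2 := (@lebesgue_measure R \x @lebesgue_measure R)%E.

Definition ACL2 f : Prop :=
  (forall a b c d : R, a < b -> c < d ->
     (forall x y, a <= x <= b -> c <= y <= d -> disk (x +i* y)) ->
     {ae lebesgue_measure, forall y : R, c <= y <= d ->
        abs_continuous a b (hslice f y)} /\
     {ae lebesgue_measure, forall x : R, a <= x <= b ->
        abs_continuous c d (vslice f x)}) /\
  (forall A : set (R * R), compact A -> A `<=` toC @^-1` disk ->
     lebesgue2.-integrable A (fun w => (cmod (dx f (toC w)) ^+ 2)%:E) /\
     lebesgue2.-integrable A (fun w => (cmod (dy f (toC w)) ^+ 2)%:E)).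

(* An ACL function has partial derivatives only almost everywhere. When f is
   continuously differentiable, the Jacobian is continuous, and this says that
   it is nonnegative at every point of the disk. *)
Definition sense_preserving f : Prop :=
  {ae lebesgue2, forall w, disk (toC w) -> 0 <= Jacobian f (toC w)}.

Definition quasiregular (K : R) f : Prop :=
  [/\ continuous_disk f, ACL2 f, sense_preserving f,
      {ae lebesgue2, forall w, disk (toC w) -> Jacobian f (toC w) != 0} &
      {ae lebesgue2, forall w, disk (toC w) ->
         Lambda_ f (toC w) ^+ 2 <= K * Jacobian f (toC w)}].

(* sum_(n >= 1) c_n z^n converges on the whole disk, i.e. defines an analytic
   function there. *)
Definition analytic_series (c : nat -> R[i]) : Prop :=
  forall z, disk z -> cvgn (fun N => \sum_(1 <= n < N) c n * z ^+ n).

Definition harmonic_series (c d : nat -> R[i]) z : R[i] :=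
  limn (fun N => \sum_(1 <= n < N) (c n * z ^+ n + conjc (d n * z ^+ n))).

End complex_plane.

(* Main.v *)
Require Import Defs.
From HB Require Import structures.
From mathcomp Require Import all_boot all_order all_algebra.
From mathcomp Require Import all_classical all_reals all_analysis.
From mathcomp Require Import complex.
From mathcomp Require Import cyclic separable cyclotomic.
From mathcomp Require Import ring lra.
Set Implicit Arguments.
Unset Strict Implicit.
Unset Printing Implicit Defensive.
Import Order.TTheory GRing.Theory Num.Theory.
Import numFieldNormedType.Exports.
Local Open Scope classical_set_scope.
Local Open Scope ring_scope.
Local Open Scope complex_scope.

(* Quasiregularity gives [Lambda_ F <= K lambda_ F <= K lambda], first almost
   everywhere and then everywhere by continuity, so that
   [|F_z|^2 + |F_zbar|^2 = (Lambda_^2 + lambda_^2) / 2 <= (K^2 + 1) lambda^2 / 2].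
   On the circle [|z| = r] the functions [z F_z] and [zbar F_zbar] are absolutely
   convergent trigonometric series, and Parseval's identity, applied to partial
   sums sampled at roots of unity, bounds the sum of the squared moduli of their
   coefficients. These coefficients are sums over [k] of nonnegative multiples of
   the [a n k] or of the [b n k]; the condition on the arguments makes the cross
   terms nonnegative, so the square of such a sum dominates the sum of the squares.
   Letting [r] tend to 1,
     [sum_(n, k) ((n + k - 1)^2 + (k - 1)^2) (|a n k|^2 + |b n k|^2)
        <= (K^2 + 1) lambda^2 / 2],
   where the term [(1, 1)] is at least 1 because [lambda_ F 0 = 1]. *)

(** * Complex modulus *)

Section cmod_theory.
Context {R : realType}.
Implicit Types (x y z w : R[i]) (r e : R).

Lemma cmod_sqrt z : cmod z = Num.sqrt (complex.Re z ^+ 2 + complex.Im z ^+ 2).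
Proof. by case: z. Qed.

Lemma normC_cmod z : `|z| = (cmod z)%:C.
Proof. by rewrite normc_def cmod_sqrt. Qed.

Lemma cmod_ge0 z : 0 <= cmod z.
Proof. by rewrite cmod_sqrt sqrtr_ge0. Qed.

Lemma cmod_sqr z : cmod z ^+ 2 = complex.Re z ^+ 2 + complex.Im z ^+ 2.
Proof. by rewrite cmod_sqrt sqr_sqrtr // addr_ge0 ?sqr_ge0. Qed.

Lemma cmodM x y : cmod (x * y) = cmod x * cmod y.
Proof. exact: Normc.normcM. Qed.

Lemma cmodN x : cmod (- x) = cmod x.
Proof. by rewrite !cmod_sqrt; case: x => a b /=; rewrite !sqrrN. Qed.

Lemma cmodD x y : cmod (x + y) <= cmod x + cmod y.
Proof. by rewrite -lecR rmorphD /= -!normC_cmod ler_normD. Qed.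

Lemma cmodB x y : cmod (x - y) <= cmod x + cmod y.
Proof. by rewrite -(cmodN y) cmodD. Qed.

Lemma cmod_distC x y : cmod (x - y) = cmod (y - x).
Proof. by rewrite -cmodN opprB. Qed.

Lemma cmod0 : cmod (0 : R[i]) = 0.
Proof. exact: Normc.normc0. Qed.

Lemma cmod1 : cmod (1 : R[i]) = 1.
Proof. exact: Normc.normc1. Qed.

Lemma cmod_eq0 z : (cmod z == 0) = (z == 0).
Proof.
apply/eqP/eqP => [|->]; [exact: Normc.eq0_normc | exact: cmod0].
Qed.

Lemma cmodX z n : cmod (z ^+ n) = cmod z ^+ n.
Proof.
elim: n => [|n IHn]; first by rewrite !expr0 cmod1.
by rewrite !exprS cmodM IHn.
Qed.

Lemma cmod_conj z : cmod (conjc z) = cmod z.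
Proof. by rewrite !cmod_sqrt; case: z => a b /=; rewrite sqrrN. Qed.

Lemma cmod_real r : cmod (r%:C) = `|r|.
Proof. by rewrite cmod_sqrt /= expr0n addr0 sqrtr_sqr. Qed.

Lemma cmod_nat n : cmod (n%:R : R[i]) = n%:R.
Proof. by rewrite -(rmorph_nat (real_complex R)) cmod_real ger0_norm. Qed.

Lemma cmod_i : cmod (0 +i* 1 : R[i]) = 1.
Proof. by rewrite cmod_sqrt /= expr0n expr1n add0r sqrtr1. Qed.

Lemma cmod_sum (I : Type) (s : seq I) (P : pred I) (f : I -> R[i]) :
  cmod (\sum_(i <- s | P i) f i) <= \sum_(i <- s | P i) cmod (f i).
Proof.
elim/big_rec2: _ => [|i y1 y2 _ le_y]; first by rewrite cmod0.
by rewrite (le_trans (cmodD _ _)) // lerD2l.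
Qed.

Lemma Re_le_cmod z : `|complex.Re z| <= cmod z.
Proof.
rewrite -(@ler_pXn2r _ 2) ?nnegrE ?cmod_ge0 //.
by rewrite cmod_sqr real_normK ?num_real // lerDl sqr_ge0.
Qed.

Lemma cmod_le_ReIm z : cmod z <= `|complex.Re z| + `|complex.Im z|.
Proof.
rewrite -(@ler_pXn2r _ 2) ?nnegrE ?cmod_ge0 ?addr_ge0 // cmod_sqr.
rewrite sqrrD !real_normK ?num_real //.
by rewrite [leRHS]addrAC lerDl mulrn_wge0 ?mulr_ge0.
Qed.

Lemma Re_mulcJ z w : complex.Re (z * conjc w) =
  complex.Re z * complex.Re w + complex.Im z * complex.Im w.
Proof. by case: z w => a b [c d] /=; ring. Qed.

Lemma mulcJ z : z * conjc z = (cmod z ^+ 2)%:C.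
Proof. by rewrite -sqr_normc normC_cmod rmorphXn. Qed.

Lemma cmod_sqrD x y :
  cmod (x + y) ^+ 2 =
    cmod x ^+ 2 + cmod y ^+ 2 + 2%:R * complex.Re (x * conjc y).
Proof. by rewrite Re_mulcJ !cmod_sqr; case: x y => a b [c d] /=; ring. Qed.

Lemma conjcD x y : conjc (x + y) = conjc x + conjc y :> R[i].
Proof. exact: rmorphD. Qed.

Lemma conjcM x y : conjc (x * y) = conjc x * conjc y :> R[i].
Proof. exact: rmorphM. Qed.

Lemma conjcX x n : conjc (x ^+ n) = conjc x ^+ n :> R[i].
Proof. exact: rmorphXn. Qed.

Lemma conj_realM r z : conjc (r%:C * z) = r%:C * conjc z.
Proof. by rewrite conjcM conjc_real. Qed.

(** The norm of [R[i]] takes its values in [R[i]]. A positive element there is a positive real, so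
    real tolerances suffice. *)
Lemma cvg_cmodP (u : nat -> R[i]) (l : R[i]) :
  (u n @[n --> \oo] --> l) <->
  (forall e, 0 < e -> exists N, forall n, (N <= n)%N -> cmod (u n - l) < e).
Proof.
split=> [/cvgrPdistC_lt ul e e0|ul].
  have e0' : 0 < e%:C by rewrite ltcR.
  have [N _ HN] := ul _ e0'; exists N => n Nn.
  by have /= := HN n Nn; rewrite normC_cmod ltcR.
apply/cvgrPdistC_lt => e.
rewrite ltcE => /andP[/eqP /= e_real e0].
have [N HN] := ul _ e0; exists N => // n /= Nn.
rewrite (_ : e = (complex.Re e)%:C) ?normC_cmod ?ltcR; first exact: HN.
by case: e e_real {e0 HN} => a b /= ->.
Qed.

Lemma cmod_lim_le (u : nat -> R[i]) (l : R[i]) r :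
  u n @[n --> \oo] --> l ->
  (exists N, forall n, (N <= n)%N -> cmod (u n) <= r) -> cmod l <= r.
Proof.
move=> /cvg_cmodP ul [N ur]; apply/ler_addgt0Pr => e e0.
have [N' HN'] := ul _ e0.
pose n := maxn N N'.
have -> : l = u n - (u n - l) by ring.
by rewrite (le_trans (cmodB _ _)) // lerD ?ur ?leq_maxl // ltW // HN' ?leq_maxr.
Qed.

End cmod_theory.

(** * Wirtinger derivatives *)

Section wirtinger.
Context {R : realType}.
Implicit Types (x y z w A B c : R[i]) (f g : R[i] -> R[i]) (r e : R).

(** As [|z|^2 = z zbar], every term of the expansion is a combination of such monomials. *)
Definition mono (s t : nat) z : R[i] := z ^+ s * conjc z ^+ t.

(** Factor [w - z] out of [w^n - z^n]; the cofactor is a sum of [n] products, each of modulus at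
    most [r^(n-1)]. *)
Lemma cmod_exp_lip n r z w : cmod z <= r -> cmod w <= r ->
  cmod (w ^+ n - z ^+ n) <= n%:R * r ^+ n.-1 * cmod (w - z).
Proof.
move=> zr wr; rewrite subrXX cmodM mulrC ler_wpM2r ?cmod_ge0 //.
apply: (le_trans (cmod_sum _ _ _)).
apply: (@le_trans _ _ (\sum_(i < n) r ^+ n.-1)); last first.
  by rewrite sumr_const card_ord mulr_natl.
apply: ler_sum => i _; rewrite cmodM !cmodX.
have -> : n.-1 = ((n.-1 - i) + i)%N.
  by rewrite subnK // -ltnS (ltn_predK (ltn_ord i)).
rewrite exprD addnK.
by rewrite ler_pM ?exprn_ge0 ?cmod_ge0 // lerXn2r ?nnegrE ?cmod_ge0 //
           (le_trans (cmod_ge0 z)).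
Qed.

Lemma cmod_mono_lip s t r z w : cmod z <= r -> cmod w <= r ->
  cmod (mono s t w - mono s t z)
    <= (s + t)%:R * r ^+ (s + t).-1 * cmod (w - z).
Proof.
move=> zr wr; have r0 : 0 <= r by rewrite (le_trans (cmod_ge0 z)).
have -> : mono s t w - mono s t z = (w ^+ s - z ^+ s) * conjc w ^+ t +
    z ^+ s * (conjc w ^+ t - conjc z ^+ t) by rewrite /mono; ring.
have Ht : cmod (conjc w ^+ t - conjc z ^+ t)
    <= t%:R * r ^+ t.-1 * cmod (w - z).
  by rewrite -!rmorphXn -rmorphB cmod_conj cmod_exp_lip.
have Hs := @cmod_exp_lip s r z w zr wr.
have wt : cmod (conjc w ^+ t) <= r ^+ t.
  by rewrite cmodX cmod_conj lerXn2r ?nnegrE ?cmod_ge0.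
have zs : cmod (z ^+ s) <= r ^+ s.
  by rewrite cmodX lerXn2r ?nnegrE ?cmod_ge0.
apply: (le_trans (cmodD _ _)); rewrite !cmodM.
apply: (@le_trans _ _ (s%:R * r ^+ s.-1 * cmod (w - z) * r ^+ t +
                      r ^+ s * (t%:R * r ^+ t.-1 * cmod (w - z)))).
  by rewrite lerD ?ler_pM ?cmod_ge0.
(* The two bounds add up exactly to the claim. Zero exponents are treated apart because [.-1]
   truncates at 0. *)
rewrite le_eqVlt; apply/orP; left; apply/eqP.
case: s t {wt zs Hs Ht} => [|s] [|t] /=; rewrite ?addn0 ?addnS ?addSn ?add0n //=;
  rewrite ?expr0 ?mul0r ?mul1r ?mulr0 ?mulr1 ?addr0 ?add0r //.
have -> : (s + t).+2%:R = s.+1%:R + t.+1%:R :> R by rewrite -natrD addnS addSn.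
by rewrite !exprS exprD; ring.
Qed.

(** Induction: the remainder of order [n + 1] is [w] times that of order [n], plus
    [n z^(n-1) (w - z)^2], and [n^2 + n <= (n + 1)^2]. *)
Lemma cmod_exp_taylor n z w : cmod z <= 1 -> cmod w <= 1 ->
  cmod (w ^+ n - z ^+ n - n%:R * z ^+ n.-1 * (w - z))
    <= n%:R ^+ 2 * cmod (w - z) ^+ 2.
Proof.
move=> z1 w1; elim: n => [|n IHn].
  by rewrite !expr0 !mulr0n !mul0r subrr subr0 cmod0 expr0n mul0r.
have -> : w ^+ n.+1 - z ^+ n.+1 - n.+1%:R * z ^+ n.+1.-1 * (w - z) =
    w * (w ^+ n - z ^+ n - n%:R * z ^+ n.-1 * (w - z)) +
    n%:R * z ^+ n.-1 * (w - z) ^+ 2.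
  case: n {IHn} => [|n] /=; first by rewrite !expr0 !expr1; ring.
  by rewrite -[n.+2%:R]natr1 !exprS; ring.
apply: (le_trans (cmodD _ _)); rewrite !cmodM !cmodX cmod_nat.
have zn : cmod z ^+ n.-1 <= 1 by rewrite exprn_ile1 ?cmod_ge0.
apply: (@le_trans _ _ (1 * (n%:R ^+ 2 * cmod (w - z) ^+ 2) +
                      n%:R * 1 * cmod (w - z) ^+ 2)).
  apply: lerD; first by rewrite ler_pM ?cmod_ge0.
  apply: ler_wpM2r; first by rewrite mulr_ge0 ?cmod_ge0.
  by apply: ler_wpM2l.
rewrite mul1r mulr1 -mulrDl ler_wpM2r ?exprn_ge0 ?cmod_ge0 //.
by rewrite -natr1; have := ler0n R n; nra.
Qed.

Definition mono_dz s t z : R[i] := s%:R * z ^+ s.-1 * conjc z ^+ t.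
Definition mono_dzbar s t z : R[i] := t%:R * z ^+ s * conjc z ^+ t.-1.

(** The remainder of the product splits into the two remainders of the factors and the product of
    their increments; the constants satisfy [t^2 + s^2 + s t <= (s + t)^2]. *)
Lemma cmod_mono_taylor s t z w : cmod z <= 1 -> cmod w <= 1 ->
  cmod (mono s t w - mono s t z -
        (mono_dz s t z * (w - z) + mono_dzbar s t z * conjc (w - z)))
    <= (s + t)%:R ^+ 2 * cmod (w - z) ^+ 2.
Proof.
move=> z1 w1; set h := w - z.
have Zs := @cmod_exp_taylor s z w z1 w1.
have cz1 : cmod (conjc z) <= 1 by rewrite cmod_conj.
have cw1 : cmod (conjc w) <= 1 by rewrite cmod_conj.
have Zt := @cmod_exp_taylor t _ _ cz1 cw1.
have Ls := @cmod_exp_lip s 1 z w z1 w1.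
have Lt := @cmod_exp_lip t 1 _ _ cz1 cw1.
rewrite -[_ - conjc z]rmorphB -/h in Zt Lt; rewrite -/h in Zs Ls.
rewrite cmod_conj !expr1n ?mulr1 in Zt Lt Ls.
have -> : mono s t w - mono s t z -
    (mono_dz s t z * h + mono_dzbar s t z * conjc h) =
    z ^+ s * (conjc w ^+ t - conjc z ^+ t - t%:R * conjc z ^+ t.-1 * conjc h) +
    conjc z ^+ t * (w ^+ s - z ^+ s - s%:R * z ^+ s.-1 * h) +
    (w ^+ s - z ^+ s) * (conjc w ^+ t - conjc z ^+ t).
  by rewrite /mono /mono_dz /mono_dzbar; ring.
apply: (le_trans (cmodD _ _)); rewrite cmodM.
apply: (le_trans (lerD (cmodD _ _) (lexx _))); rewrite !cmodM !cmodX.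
apply: (@le_trans _ _ (1 * (t%:R ^+ 2 * cmod h ^+ 2) +
    1 * (s%:R ^+ 2 * cmod h ^+ 2) + (s%:R * cmod h) * (t%:R * cmod h))).
  by rewrite !lerD ?ler_pM ?exprn_ge0 ?cmod_ge0 ?exprn_ile1 ?cmod_ge0.
have -> : 1 * (t%:R ^+ 2 * cmod h ^+ 2) + 1 * (s%:R ^+ 2 * cmod h ^+ 2) +
    (s%:R * cmod h) * (t%:R * cmod h) =
    (t%:R ^+ 2 + s%:R ^+ 2 + s%:R * t%:R) * cmod h ^+ 2 by ring.
rewrite ler_wpM2r ?exprn_ge0 ?cmod_ge0 //.
by rewrite natrD; have := ler0n R s; have := ler0n R t; nra.
Qed.

(* [f] has the real-linear approximation [h |-> A h + B conj(h)] at [z], up to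
   a linear error of slope [e]; for [e = 0+] this says [A = f_z], [B = f_zbar]. *)
Definition wirtinger_approx f z A B e : Prop :=
  exists2 d : R, 0 < d & forall w, cmod (w - z) < d ->
    cmod (f w - f z - (A * (w - z) + B * conjc (w - z))) <= e * cmod (w - z).

Lemma wirtinger_approxD f g z A B A' B' e e' :
  wirtinger_approx f z A B e -> wirtinger_approx g z A' B' e' ->
  wirtinger_approx (fun w => f w + g w) z (A + A') (B + B') (e + e').
Proof.
move=> [d d0 fd] [d' d'0 gd]; exists (Num.min d d').
  by rewrite lt_min d0 d'0.
move=> w; rewrite lt_min => /andP[wd wd'].
set X := f w - f z - (A * (w - z) + B * conjc (w - z)).
set Y := g w - g z - (A' * (w - z) + B' * conjc (w - z)).
rewrite (_ : cmod _ = cmod (X + Y)); last by congr cmod; rewrite /X /Y; ring.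
rewrite mulrDl (le_trans (cmodD _ _)) // lerD ?fd ?gd //.
Qed.

Lemma wirtinger_approx_cst c z : wirtinger_approx (fun=> c) z 0 0 0.
Proof. by exists 1 => // w _; rewrite subrr !mul0r addr0 subr0 cmod0. Qed.

Lemma wirtinger_approx_mono c s t z e : 0 < e -> cmod z < 1 ->
  wirtinger_approx (fun w => c * mono s t w) z
    (c * mono_dz s t z) (c * mono_dzbar s t z) e.
Proof.
move=> e0 z1.
pose C := cmod c * (s + t)%:R ^+ 2 + 1.
have C0 : 0 < C by rewrite ltr_wpDl ?mulr_ge0 ?cmod_ge0 ?exprn_ge0.
(* The first radius keeps [w] in the closed unit disk, where the quadratic remainder bound holds;
   the second turns that bound into a linear one of slope [e]. *)
exists (Num.min (1 - cmod z) (e / C)) => [|w].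
  by rewrite lt_min subr_gt0 z1 divr_gt0.
rewrite lt_min => /andP[wz we].
have w1 : cmod w <= 1.
  have -> : w = z + (w - z) by ring.
  by rewrite (le_trans (cmodD _ _)) // -lerBrDl ltW.
rewrite (_ : c * _ - _ - _ = c * (mono s t w - mono s t z -
        (mono_dz s t z * (w - z) + mono_dzbar s t z * conjc (w - z))));
  last by ring.
rewrite cmodM; have H := cmod_mono_taylor s t (ltW z1) w1.
apply: (le_trans (ler_wpM2l (cmod_ge0 _) H)).
rewrite expr2 !mulrA ler_wpM2r ?cmod_ge0 //.
apply: (@le_trans _ _ (C * cmod (w - z))).
  by rewrite ler_wpM2r ?cmod_ge0 // /C; lra.
by rewrite mulrC -ler_pdivlMr // ltW.
Qed.

Lemma wirtinger_approx_sum (I : eqType) (s : seq I) (f : I -> R[i] -> R[i])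
    z (A B : I -> R[i]) :
  (forall i e, 0 < e -> wirtinger_approx (f i) z (A i) (B i) e) ->
  forall e, 0 < e -> wirtinger_approx (fun w => \sum_(i <- s) f i w) z
    (\sum_(i <- s) A i) (\sum_(i <- s) B i) e.
Proof.
move=> fAB; elim: s => [|i s IHs] e e0.
  rewrite !big_nil; have [d d0 H] := wirtinger_approx_cst 0 z.
  exists d => // w wd; rewrite !big_nil (le_trans (H w wd)) //.
  by rewrite mul0r mulr_ge0 ?cmod_ge0 // ltW.
rewrite !big_cons.
have e20 : 0 < e / 2 by rewrite divr_gt0.
have [d d0 H] := wirtinger_approxD (fAB i _ e20) (IHs _ e20).
exists d => // w wd; rewrite !big_cons (le_trans (H w wd)) //.
by rewrite -splitr.
Qed.

(** Compare both quantities with the difference quotient at one nonzero [h], small enough for the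
    quotient to be close to the derivative and for the approximation to apply. *)
Lemma deriveC_approx (g : R -> R[i]) (t : R) c e d :
  derivableC g t -> 0 < d ->
  (forall h : R, `|h| < d ->
     cmod (g (t + h) - g t - c * h%:C) <= e * `|h|) ->
  cmod (deriveC g t - c) <= e.
Proof.
move=> [dRe dIm] d0 gd; apply/ler_addgt0Pr => eta eta0.
have eta20 : 0 < eta / 2 by rewrite divr_gt0.
have cvgd (k : R -> R) : derivable k t 1 ->
    h^-1 *: (k (h + t) - k t) @[h --> 0^'] --> derive1 k t.
  move=> /cvg_ex[l kl]; rewrite /derive1.
  have kl' : h^-1 *: (k (h + t) - k t) @[h --> 0^'] --> l.
    move: kl; rewrite /=; under eq_fun do rewrite [_%:A]mulr1; exact.
  by rewrite (cvg_lim _ kl').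
move/cvgd/cvgrPdist_lt/(_ _ eta20): dRe => dRe.
move/cvgd/cvgrPdist_lt/(_ _ eta20): dIm => dIm.
have : \forall h \near 0^', `|h : R| < d.
  exact: dnbhs0_lt.
move=> hd.
have [h [h0 [hR [hI hd']]]] : exists h : R, h != 0 /\
  (`|derive1 (fun s => complex.Re (g s)) t -
    h^-1 *: (complex.Re (g (h + t)) - complex.Re (g t))| < eta / 2 /\
  (`|derive1 (fun s => complex.Im (g s)) t -
    h^-1 *: (complex.Im (g (h + t)) - complex.Im (g t))| < eta / 2 /\
   `|h| < d)).
  apply: (@filter_ex _ (0^')).
  near=> h; split; first by near: h; exact: nbhs_dnbhs_neq.
  by split; [near: h | split; near: h].
have := gd h hd'; rewrite (addrC t) => gh.
have hC0 : h%:C != 0 :> R[i] by rewrite (inj_eq (@complexI R)).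
set q := (h%:C)^-1 * (g (h + t) - g t).
have -> : deriveC g t - c = (deriveC g t - q) + (q - c) by ring.
rewrite [e + eta]addrC (le_trans (cmodD _ _)) //; apply: lerD; last first.
  have -> : q - c = (h%:C)^-1 * (g (h + t) - g t - c * h%:C).
    by rewrite /q [in RHS]mulrBr mulrCA mulVf // mulr1.
  rewrite cmodM Normc.normcV cmod_real mulrC ler_pdivrMr ?normr_gt0 //.
apply: (le_trans (cmod_le_ReIm _)).
rewrite (splitr eta) lerD //; apply/ltW.
  rewrite (_ : complex.Re (deriveC g t - q) = derive1 (fun s => complex.Re (g s)) t -
    h^-1 *: (complex.Re (g (h + t)) - complex.Re (g t))) //.
  rewrite /q -fmorphV raddfB /=; case: (g (h + t)) (g t) => [a b] [a' b'] /=.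
  by rewrite mul0r subr0.
rewrite (_ : complex.Im (deriveC g t - q) = derive1 (fun s => complex.Im (g s)) t -
    h^-1 *: (complex.Im (g (h + t)) - complex.Im (g t))) //.
rewrite /q -fmorphV raddfB /=; case: (g (h + t)) (g t) => [a b] [a' b'] /=.
by rewrite mul0r addr0.
Unshelve. all: by end_near. Qed.

(** Horizontal increments put [dx f z] within [e] of [A + B], vertical ones put [dy f z] within [e]
    of [i (A - B)]. The halved combinations defining [dz] and [dzbar] then differ from [A] and [B]
    by at most [e]. *)
Lemma dz_dzbar_approx f z A B e :
  derivableC (hslice f (complex.Im z)) (complex.Re z) ->
  derivableC (vslice f (complex.Re z)) (complex.Im z) ->
  wirtinger_approx f z A B e ->
  cmod (dz f z - A) <= e /\ cmod (dzbar f z - B) <= e.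
Proof.
move=> dh dv [d d0 fd].
have Hx : cmod (dx f z - (A + B)) <= e.
  apply: (deriveC_approx dh d0) => h hd.
  have := fd (z + h%:C); rewrite addrC addKr cmod_real => /(_ hd).
  rewrite conjc_real -mulrDl /hslice; congr (cmod (_ - _ - _) <= _).
    by congr f; case: (z) => x y; apply/eqP; rewrite eq_complex /= addr0 !eqxx.
  by case: (z).
have Hy : cmod (dy f z - (0 +i* 1) * (A - B)) <= e.
  apply: (deriveC_approx dv d0) => h hd.
  have := fd (z + (0 +i* 1) * h%:C).
  rewrite addrC addKr cmodM cmod_real cmod_i mul1r => /(_ hd).
  have -> : conjc ((0 +i* 1) * h%:C) = - (0 +i* 1) * h%:C.
    by apply/eqP; rewrite eq_complex /=; apply/andP; split; apply/eqP; ring.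
  congr (cmod (_ - _ - _) <= _).
  - congr f; case: (z) => x y; apply/eqP; rewrite eq_complex /=.
    by rewrite !(mul0r, mul1r, mulr0, addr0, subr0, add0r) !eqxx.
  - by case: (z).
  - by ring.
have n2 : cmod (2%:R : R[i])^-1 = 2%:R^-1 by rewrite Normc.normcV cmod_nat.
have ii : (0 +i* 1) * (0 +i* 1) = -1 :> R[i] by rewrite -expr2; exact: sqr_i.
have dA : dz f z - A = ((dx f z - (A + B)) -
    (0 +i* 1) * (dy f z - (0 +i* 1) * (A - B))) / 2%:R.
  rewrite /dz (_ : A = 2%:R * A / 2%:R); last first.
    by rewrite mulrAC divff ?mul1r ?pnatr_eq0.
  rewrite -mulrBl; congr (_ / _).
  rewrite [in RHS]mulrAC divff ?mul1r ?pnatr_eq0 // mulrBr mulrA ii; ring.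
have dB : dzbar f z - B = ((dx f z - (A + B)) +
    (0 +i* 1) * (dy f z - (0 +i* 1) * (A - B))) / 2%:R.
  rewrite /dzbar (_ : B = 2%:R * B / 2%:R); last first.
    by rewrite mulrAC divff ?mul1r ?pnatr_eq0.
  rewrite -mulrBl; congr (_ / _).
  rewrite [in RHS]mulrAC divff ?mul1r ?pnatr_eq0 // mulrBr mulrA ii; ring.
split; rewrite ?dA ?dB cmodM n2 ler_pdivrMr ?ltr0n // mulr_natr mulr2n.
  by rewrite (le_trans (cmodB _ _)) // cmodM cmod_i mul1r lerD.
by rewrite (le_trans (cmodD _ _)) // cmodM cmod_i mul1r lerD.
Qed.

End wirtinger.

(** * Parseval's identity on roots of unity *)

Section discrete_parseval.
Context {R : realType}.
Implicit Types (z u v : R[i]) (r S : R) (x y : nat -> R[i]).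

(** The polynomial [X^n - 1] splits over [R[i]] and is separable, so it has [n] distinct roots,
    among which one is primitive. *)
Lemma C_prim_root n : (0 < n)%N -> exists v : R[i], n.-primitive_root v.
Proof.
move=> n0; pose q : {poly R[i]} := 'X^n - 1.
have [s Dq] := closed_field_poly_normal q.
rewrite (monicP _) ?monicXnsubC // scale1r in Dq.
have s1 : all n.-unity_root s by apply/allP => v; rewrite -root_prod_XsubC -Dq.
have sz : (n < (size s).+1)%N.
  by rewrite -(size_prod_XsubC s id) -Dq size_XnsubC.
have [|v] := hasP (has_prim_root n0 s1 _ sz); last by exists v.
by rewrite -separable_prod_XsubC -Dq separable_Xn_sub_1 // pnatr_eq0 -lt0n.
Qed.

Lemma cmod_root1 n v : (0 < n)%N -> v ^+ n = 1 -> cmod v = 1.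
Proof.
move=> n0 vn; apply/eqP; rewrite -(@pexpr_eq1 _ _ n) ?cmod_ge0 //.
by rewrite -cmodX vn cmod1.
Qed.

Lemma sum_root1 n u : u ^+ n = 1 -> u != 1 -> \sum_(j < n) u ^+ j = 0.
Proof.
move=> un u1; apply: (mulfI (_ : u - 1 != 0)); first by rewrite subr_eq0.
by rewrite mulr0 -subrX1 un subrr.
Qed.

(** Expand the squares. Distinct frequencies below [n] are distinct modulo [n], so each off-diagonal
    term is a full geometric sum of a nontrivial root of unity, which vanishes. *)
Lemma sum_cmod_sqr_dft n m v x : n.-primitive_root v -> (m <= n)%N ->
  \sum_(j < n) cmod (\sum_(1 <= l < m) x l * (v ^+ j) ^+ l) ^+ 2 =
    n%:R * \sum_(1 <= l < m) cmod (x l) ^+ 2.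
Proof.
move=> pv mn; have vn := prim_expr_order pv.
have cv : v * conjc v = 1.
  by rewrite mulcJ (cmod_root1 (prim_order_gt0 pv) vn) expr1n.
have cvn : conjc v ^+ n = 1 by rewrite -[LHS]rmorphXn vn rmorph1.
apply: (@complexI R); rewrite rmorphM !rmorph_sum /= rmorph_nat.
under eq_bigr do rewrite -mulcJ rmorph_sum big_distrlr /=.
rewrite exchange_big mulr_sumr /=; apply: eq_big_nat => k /andP[k1 km].
rewrite exchange_big /=.
rewrite (bigD1_seq k) ?mem_index_iota ?k1 ?iota_uniq //= [X in _ + X]big1_seq ?addr0.
  transitivity (\sum_(j < n) x k * conjc (x k)); last first.
    by rewrite sumr_const card_ord mulcJ mulr_natl.
  apply: eq_bigr => j _; rewrite rmorphM mulrACA -[RHS]mulr1; congr (_ * _).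
  by rewrite rmorphXn -exprMn rmorphXn -exprMn cv !expr1n.
move=> l /andP[lk]; rewrite mem_index_iota => /andP[l1 lm].
have uE j : x k * (v ^+ j) ^+ k * conjc (x l * (v ^+ j) ^+ l) =
    x k * conjc (x l) * (v ^+ k * conjc v ^+ l) ^+ j.
  rewrite rmorphM !rmorphXn exprMn -!exprM mulrACA.
  by rewrite (mulnC k) (mulnC l).
under eq_bigr do rewrite uE.
rewrite -mulr_sumr sum_root1 ?mulr0 //.
  by rewrite exprMn -!exprM (mulnC k) (mulnC l) !exprM vn cvn !expr1n mulr1.
apply/negP => /eqP u1; have : v ^+ k = v ^+ l.
  by rewrite -[v ^+ k]mulr1 -(expr1n _ l) -cv mulrC exprMn -mulrA
     (mulrC (conjc v ^+ l)) u1 mulr1.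
move/eqP; rewrite (eq_prim_root_expr pv) !modn_small ?(leq_trans _ mn) //.
by rewrite eq_sym (negPf lk).
Qed.

(** Without conjugation the frequencies add up to [k + l], which lies strictly between 0 and [n];
    this is why at least [2 m] sample points are taken. *)
Lemma sum_mul_dft0 n m v x y : n.-primitive_root v -> (m.*2 <= n)%N ->
  \sum_(j < n) (\sum_(1 <= l < m) x l * (v ^+ j) ^+ l) *
    (\sum_(1 <= l < m) y l * (v ^+ j) ^+ l) = 0.
Proof.
move=> pv mn; under eq_bigr do rewrite big_distrlr /=.
rewrite exchange_big big1_seq //= => k.
rewrite mem_index_iota => /andP[k1 km].
rewrite exchange_big big1_seq //= => l.
rewrite mem_index_iota => /andP[l1 lm].
have uE j : x k * (v ^+ j) ^+ k * (y l * (v ^+ j) ^+ l) =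
    x k * y l * (v ^+ (k + l)) ^+ j.
  by rewrite mulrACA -exprD -!exprM mulnC.
under eq_bigr do rewrite uE.
rewrite -mulr_sumr sum_root1 ?mulr0 //.
  by rewrite -exprM mulnC exprM (prim_expr_order pv) expr1n.
rewrite -(prim_order_dvd pv) gtnNdvd ?addn_gt0 ?k1 //.
by rewrite (leq_trans _ mn) // -addnn -addnS leq_add // ltnW.
Qed.

Definition trig_poly m x y z : R[i] :=
  \sum_(1 <= l < m) (x l * z ^+ l + conjc (y l * z ^+ l)).

(** Apart from the two diagonal sums, only the cross term between the part in [z] and the part in
    [zbar] remains, and it sums to 0 by [sum_mul_dft0]. *)
Lemma sum_cmod_sqr_trig_poly n m r v x y :
  n.-primitive_root v -> (m.*2 <= n)%N ->
  \sum_(j < n) cmod (trig_poly m x y (r%:C * v ^+ j)) ^+ 2 =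
    n%:R * \sum_(1 <= l < m)
      r ^+ (2 * l) * (cmod (x l) ^+ 2 + cmod (y l) ^+ 2).
Proof.
move=> pv mn.
pose D (c : nat -> R[i]) (j : nat) :=
  \sum_(1 <= l < m) (c l * r%:C ^+ l) * (v ^+ j) ^+ l.
have E (j : nat) : cmod (trig_poly m x y (r%:C * v ^+ j)) ^+ 2 =
    cmod (D x j) ^+ 2 + cmod (D y j) ^+ 2 + 2%:R * complex.Re (D x j * D y j).
  rewrite (_ : trig_poly _ _ _ _ = D x j + conjc (D y j)).
    by rewrite cmod_sqrD conjcK cmod_conj.
  rewrite /trig_poly /D big_split rmorph_sum; congr (_ + _).
    by apply: eq_bigr => l _; rewrite exprMn mulrA.
  by apply: eq_bigr => l _; rewrite exprMn mulrA.
under eq_bigr do rewrite E.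
have m_n : (m <= n)%N by rewrite (leq_trans _ mn) // -addnn leq_addr.
rewrite !big_split /= !(sum_cmod_sqr_dft _ pv m_n) -mulr_sumr.
have -> : \sum_(j < n) complex.Re (D x j * D y j) =
    complex.Re (\sum_(j < n) D x j * D y j).
  rewrite (big_morph (@complex.Re R) (id1 := 0) (op1 := +%R)) //.
  by case=> ? ? [].
rewrite (sum_mul_dft0 _ _ pv mn) /= mulr0 addr0 -mulrDr -big_split /=.
congr (_ * _); apply: eq_bigr => l _.
rewrite !cmodM -!rmorphXn !cmod_real !exprMn !real_normK ?num_real //.
by rewrite -exprM mulnC; ring.
Qed.

(** Average the hypothesis over equally spaced points of the circle. Two polynomials are treated
    together because [F_z] and [F_zbar] are bounded jointly. *)
Lemma trig_poly_bessel m r S x y x' y' :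
  (forall z, cmod z = `|r| ->
    cmod (trig_poly m x y z) ^+ 2 + cmod (trig_poly m x' y' z) ^+ 2 <= S) ->
  \sum_(1 <= l < m) r ^+ (2 * l) * ((cmod (x l) ^+ 2 + cmod (y l) ^+ 2) +
    (cmod (x' l) ^+ 2 + cmod (y' l) ^+ 2)) <= S.
Proof.
move=> TS; pose n := (m.*2).+1.
have [v pv] := C_prim_root (ltn0Sn m.*2).
have mn : (m.*2 <= n)%N by [].
have n0 : 0 < n%:R :> R by rewrite ltr0n.
rewrite -(ler_pM2l n0).
under eq_bigr do rewrite mulrDr.
rewrite big_split mulrDr -!(sum_cmod_sqr_trig_poly r _ _ pv mn) -big_split /=.
apply: (@le_trans _ _ (\sum_(j < n) S)); last first.
  by rewrite sumr_const card_ord mulr_natl.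
apply: ler_sum => j _; apply: TS.
by rewrite cmodM cmod_real cmodX (cmod_root1 (ltn0Sn _) (prim_expr_order pv))
   expr1n mulr1.
Qed.

End discrete_parseval.

(** * Pointwise form of quasiregularity *)

Section quasiregular_pointwise.
Context {R : realType}.
Implicit Types (z : R[i]) (f : R[i] -> R[i]) (u : R[i] -> R).

Lemma cmod_dist (x y : R[i]) : `|cmod x - cmod y| <= cmod (x - y).
Proof.
rewrite ler_norml; apply/andP; split.
  by have := cmodD (y - x) x; rewrite subrK cmod_distC; lra.
by have := cmodD (x - y) y; rewrite subrK; lra.
Qed.

Lemma cvg_cmod_near (g : R[i] -> R[i]) z : g w @[w --> z] --> g z ->
  forall e : R, 0 < e -> \forall w \near nbhs z, cmod (g z - g w) < e.
Proof.
move=> /(cvgrPdist_lt (FF := nbhs_filter z)) gz e e0.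
have e0' : 0 < e%:C by rewrite ltcR.
move: (gz _ e0'); apply: (@filterS _ (nbhs z) (nbhs_filter z)) => w.
by rewrite normC_cmod ltcR.
Qed.

(* A set where [u] is positive near some point contains a square, hence is not
   negligible. *)
Lemma ae_disk_le0 u : (forall z, disk z -> u w @[w --> z] --> u z) ->
  {ae lebesgue2, forall w : R * R, disk (toC w) -> u (toC w) <= 0} ->
  forall z, disk z -> u z <= 0.
Proof.
move=> u_cont [N [mN N0 PN]] z zD.
rewrite leNgt; apply/negP => uz0.
have /nbhs_normP[e /= e0 he] : \forall w \near z, 0 < u w.
  exact: (cvgr_gt _ (u_cont z zD)).
move: e0; rewrite ltcE => /andP[/eqP /= e_real e0].
have {}he w : cmod (w - z) < complex.Re e -> 0 < u w.
  move=> wz; apply: he; rewrite /ball_ /= normC_cmod cmod_distC.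
  by rewrite ltcE /= e_real eqxx.
(* The minimum is halved because the distance to [z] is bounded by the sum of the two coordinate
   differences. *)
pose d := Num.min (complex.Re e) (1 - cmod z) / 2.
have d0 : 0 < d by rewrite divr_gt0 // lt_min e0 subr_gt0 zD.
pose X := `]complex.Re z - d, complex.Re z + d[%classic : set R.
pose Y := `]complex.Im z - d, complex.Im z + d[%classic : set R.
have XYN : X `*` Y `<=` N.
  move=> [x y] [/= Xx Yy]; apply: PN => /= H.
  have xyz : cmod (toC (x, y) - z) < d + d.
    apply: (le_lt_trans (cmod_le_ReIm _)); rewrite /toC.
    move: Xx Yy; rewrite /X /Y /= !in_itv /=; case: (z) => a b /=.
    by move=> ? ?; apply: ltrD; rewrite ltr_norml; lra.
  move: xyz; rewrite -splitr lt_min => /andP[xye xy1].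
  have xyD : disk (toC (x, y)).
    have -> : toC (x, y) = z + (toC (x, y) - z) by ring.
    rewrite /disk /=.
    by apply: (le_lt_trans (cmodD _ _)); rewrite -ltrBrDl.
  by have := H xyD; rewrite leNgt he.
have mX : measurable X by exact: measurable_itv.
have mY : measurable Y by exact: measurable_itv.
have : (lebesgue2 (X `*` Y) <= lebesgue2 N)%E.
  by apply: le_measure; rewrite ?inE //; exact: measurableX.
have itv_d (c : R) :
    lebesgue_measure (`]c - d, c + d[%classic : set R) = (d + d)%:E.
  rewrite lebesgue_measure_itv /= lte_fin ltrD2l gtrN // -EFinD.
  by congr (_%:E); ring.
have XY : lebesgue2 (X `*` Y) = ((d + d)%:E * (d + d)%:E)%E.
  by rewrite /lebesgue2 product_measure1E //; congr (_ * _)%E; exact: itv_d.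
rewrite N0 XY leNgt -EFinM lte_fin => /negP; apply.
by rewrite mulr_gt0 //; lra.
Qed.

(** For [p >= 1] the mapping is at least twice continuously differentiable, so [dx f] and [dy f] are
    continuous in the disk. *)
Lemma polyharmonic_cvg_cmod_dz p f z : (1 <= p)%N -> polyharmonic p f -> disk z ->
  (cmod (dz f w) @[w --> z] --> cmod (dz f z)) /\
  (cmod (dzbar f w) @[w --> z] --> cmod (dzbar f z)).
Proof.
case: p => // p _ [+ _] zD; rewrite mulnS => -[_ _ _ fx fy].
have /cvg_cmod_near cx : dx f w @[w --> z] --> dx f z.
  by case: fx => H _ _ _ _; exact: (H z zD).
have /cvg_cmod_near cy : dy f w @[w --> z] --> dy f z.
  by case: fy => H _ _ _ _; exact: (H z zD).
have n2 : cmod (2%:R : R[i])^-1 = 2%:R^-1 by rewrite Normc.normcV cmod_nat.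
split; apply/(cvgrPdist_lt (FF := nbhs_filter z)) => e e0.
  apply: (@filterS2 _ (nbhs z) (nbhs_filter z) _ _ _ _ (cx _ e0) (cy _ e0)) => w X Y.
  apply: (le_lt_trans (cmod_dist _ _)).
  rewrite /dz -mulrBl cmodM n2 ltr_pdivrMr // mulr_natr mulr2n.
  rewrite (_ : _ - _ - _ = (dx f z - dx f w) - (0 +i* 1) * (dy f z - dy f w));
    last by ring.
  apply: (le_lt_trans (cmodB _ _)).
  by rewrite cmodM cmod_i mul1r; exact: ltrD X Y.
apply: (@filterS2 _ (nbhs z) (nbhs_filter z) _ _ _ _ (cx _ e0) (cy _ e0)) => w X Y.
apply: (le_lt_trans (cmod_dist _ _)).
rewrite /dzbar -mulrBl cmodM n2 ltr_pdivrMr // mulr_natr mulr2n.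
rewrite (_ : _ + _ - _ = (dx f z - dx f w) + (0 +i* 1) * (dy f z - dy f w));
  last by ring.
apply: (le_lt_trans (cmodD _ _)).
by rewrite cmodM cmod_i mul1r; exact: ltrD X Y.
Qed.

Lemma polyharmonic_derivableC p f z : (1 <= p)%N -> polyharmonic p f -> disk z ->
  derivableC (hslice f (complex.Im z)) (complex.Re z) /\
  derivableC (vslice f (complex.Re z)) (complex.Im z).
Proof.
case: p => // p _ [+ _] zD; rewrite mulnS => -[_ fx fy _ _].
by split; [exact: fx | exact: fy].
Qed.

(** By continuity [Lambda_^2 <= K J] holds at every point, and [J] is the product of [Lambda_] and
    [|f_z| - |f_zbar|]; cancel [Lambda_] where it is positive. *)
Lemma quasiregular_Lambda_le (K : R) p f z : 0 <= K -> (1 <= p)%N ->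
  polyharmonic p f -> quasiregular K f -> disk z ->
  Lambda_ f z <= K * lambda_ f z.
Proof.
move=> K0 p1 fp [_ _ _ _ qc] zD.
pose u w := Lambda_ f w ^+ 2 - K * Jacobian f w.
have : u z <= 0.
  apply: ae_disk_le0 z zD => [z zD|].
    have [cz czb] := polyharmonic_cvg_cmod_dz p1 fp zD.
    pose q (s t : R) := (s + t) ^+ 2 - K * (s ^+ 2 - t ^+ 2).
    have q_cvg (G : set_system R[i]) (FG : Filter G) (s t : R[i] -> R) (s0 t0 : R) :
        s w @[w --> G] --> s0 -> t w @[w --> G] --> t0 ->
        q (s w) (t w) @[w --> G] --> q s0 t0.
      move=> cs ct; apply: cvgB; first by apply: cvgM; exact: cvgD.
      by apply: cvgM; [exact: cvg_cst | apply: cvgB; exact: cvgM].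
    exact: (q_cvg _ (nbhs_filter z) _ _ _ _ cz czb).
  case: qc => N [mN N0 PN]; exists N; split=> // w /= uw; apply: PN => /= qw.
  by apply: uw => wD; rewrite /u subr_le0 qw.
rewrite /u /Lambda_ /Jacobian /lambda_.
set a := cmod _; set b := cmod _ => ab.
have a0 : 0 <= a := cmod_ge0 _.
have b0 : 0 <= b := cmod_ge0 _.
have Kab : K * (a - b) <= K * `|a - b| by rewrite ler_wpM2l // ler_norm.
have K0ab : 0 <= K * `|a - b| by rewrite mulr_ge0.
have [ab0|] := leP (a + b) 0; first exact: le_trans K0ab.
by move=> ab0; apply: le_trans Kab; nra.
Qed.

End quasiregular_pointwise.

(** * Tails of power series *)

Section power_series_tails.
Context {R : realType}.
Implicit Types (c : nat -> R[i]) (u v : nat -> R) (r t e : R).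

(** The terms of a convergent series are bounded: from [N] on, consecutive partial sums are within 1
    of the limit, so a term is at most 2; the earlier terms are bounded by their sum. *)
Lemma analytic_coef_bound c t : analytic_series c -> 0 <= t < 1 ->
  exists2 B, 0 <= B & forall n, (1 <= n)%N -> cmod (c n) * t ^+ n <= B.
Proof.
move=> c_an /andP[t0 t1].
have tD : disk (t%:C) by rewrite /disk /mkset cmod_real ger0_norm.
have /cvg_ex[l /cvg_cmodP /(_ 1 ltr01)[N HN]] := c_an _ tD.
have term0 k : 0 <= cmod (c k) * t ^+ k by rewrite mulr_ge0 ?cmod_ge0 ?exprn_ge0.
exists (2 + \sum_(k < N) cmod (c k) * t ^+ k) => [|n n1].
  by rewrite addr_ge0 ?sumr_ge0.
have [nN|Nn] := ltnP n N.
  rewrite (bigD1 (Ordinal nN)) //= addrCA lerDl addr_ge0 ?sumr_ge0 //.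
have := HN n.+1 (leqW Nn); have := HN n Nn.
rewrite (@big_nat_recr _ _ _ n 1) //=; set S := \sum_(1 <= _ < n) _ => H1 H2.
have -> : cmod (c n) * t ^+ n = cmod ((S + c n * t%:C ^+ n - l) - (S - l)).
  rewrite (_ : _ - _ - _ = c n * t%:C ^+ n); last by ring.
  by rewrite cmodM cmodX cmod_real ger0_norm.
rewrite (le_trans (cmodB _ _)) //.
have : 0 <= \sum_(k < N) cmod (c k) * t ^+ k by rewrite sumr_ge0.
lra.
Qed.

(** This makes [n t^n] bounded by [1 / (1 - t)], so that the factors [n] produced by differentiation
    can be absorbed. *)
Lemma natr_expr_bound n t : 0 <= t -> t <= 1 ->
  n%:R * (1 - t) * t ^+ n <= 1 - t ^+ n.
Proof.
move=> t0 t1; elim: n => [|n IHn]; first by rewrite expr0 subrr !mul0r.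
rewrite -natr1 exprS.
have tn0 : 0 <= t ^+ n by rewrite exprn_ge0.
have tn1 : t ^+ n <= 1 by rewrite exprn_ile1.
set x := t ^+ n in IHn tn0 tn1 *; set m := n%:R in IHn *.
have : t * (m * (1 - t) * x) <= t * (1 - x) by rewrite ler_wpM2l.
have : 0 <= t * x * (1 - t) <= 1 - t.
  by rewrite mulr_ge0 ?mulr_ge0 ?subr_ge0 //= ler_piMl ?subr_ge0 // mulr_ile1.
lra.
Qed.

Lemma expr_bernoulli n r : -1 <= r -> 1 + n%:R * r <= (1 + r) ^+ n.
Proof.
move=> r1; have r10 : 0 <= 1 + r by lra.
elim: n => [|n IHn]; first by rewrite mul0r addr0 expr0.
rewrite exprS; have := ler_wpM2l r10 IHn; rewrite -natr1.
by have := ler0n R n; nra.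
Qed.

(** With [r <= t^3], split [r^n] into three factors [t^n]: one bounds the coefficient, one absorbs
    [n + d], and the last gives the geometric decay. *)
Lemma analytic_coef_geometric c r d : analytic_series c -> 0 < r < 1 ->
  exists C, exists2 t, 0 <= t < 1 & forall n, (1 <= n)%N ->
    cmod (c n) * (n + d)%:R * r ^+ n.-1 <= C * t ^+ n.
Proof.
move=> c_an /andP[r0 r1].
(* Bernoulli's inequality for the exponent 3 gives [t^3 >= r] for this [t]. *)
pose t := 1 + (r - 1) / 3.
have t01 : 0 <= t < 1 by rewrite /t; apply/andP; split; lra.
have [t0 t1] := andP t01.
have rt : r <= t * t * t.
  have /(expr_bernoulli 3) : -1 <= (r - 1) / 3 by lra.
  by rewrite -/t !exprS expr0 mulr1 mulrA; lra.
have [B B0 HB] := analytic_coef_bound c_an t01.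
pose D := (1 - t)^-1 + d%:R.
have HD n : (n + d)%:R * t ^+ n <= D.
  have tn0 : 0 <= t ^+ n by rewrite exprn_ge0.
  have tn1 : t ^+ n <= 1 by rewrite exprn_ile1 ?(ltW t1).
  rewrite natrD mulrDl; apply: lerD; last by rewrite ler_piMr.
  rewrite -[_^-1]mul1r ler_pdivlMr ?subr_gt0 // mulrAC.
  by have := @natr_expr_bound n t t0 (ltW t1); lra.
exists (B * D / r), t => // n n1.
rewrite [leRHS]mulrAC ler_pdivlMr // -[leLHS]mulrA -exprSr prednK //.
have rn : r ^+ n <= t ^+ n * t ^+ n * t ^+ n.
  by rewrite -!exprMn lerXn2r ?nnegrE ?mulr_ge0 // ltW.
have tn0 : 0 <= t ^+ n by rewrite exprn_ge0.
apply: (@le_trans _ _ (cmod (c n) * (n + d)%:R * (t ^+ n * t ^+ n * t ^+ n))).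
  by rewrite ler_wpM2l ?mulr_ge0 ?cmod_ge0.
rewrite (_ : _ * _ = (cmod (c n) * t ^+ n) * ((n + d)%:R * t ^+ n) * t ^+ n);
  last by ring.
by rewrite ler_wpM2r // ler_pM ?mulr_ge0 ?cmod_ge0 ?HB.
Qed.

(** For nonnegative [u] this is the Cauchy criterion for the series, in a form that names no sum. *)
Definition small_tails u : Prop := forall e, 0 < e ->
  exists N, forall m n, (N <= m)%N -> \sum_(m <= k < n) u k <= e.

Lemma small_tailsD u v :
  small_tails u -> small_tails v -> small_tails (fun n => u n + v n).
Proof.
move=> us vs e e0; have e20 : 0 < e / 2 by rewrite divr_gt0.
have [N HN] := us _ e20; have [N' HN'] := vs _ e20.
exists (maxn N N') => m n; rewrite geq_max => /andP[Nm N'm].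
by rewrite big_split [leRHS]splitr lerD ?HN ?HN'.
Qed.

Lemma small_tails_sum (I : eqType) (s : seq I) (u : I -> nat -> R) :
  (forall i, i \in s -> small_tails (u i)) ->
  small_tails (fun n => \sum_(i <- s) u i n).
Proof.
elim: s => [_ e e0|i s IHs us].
  by exists 0%N => m n _; rewrite big1 ?ltW // => k _; rewrite big_nil.
have := small_tailsD (us i (mem_head _ _))
  (IHs (fun j js => us j (mem_behead (s := i :: s) js))).
move=> H e e0; have [N HN] := H e e0; exists N => m n Nm.
by under eq_bigr do rewrite big_cons; exact: HN.
Qed.

Lemma small_tails_geometric u C t : 0 <= t < 1 ->
  (forall n, (1 <= n)%N -> u n <= C * t ^+ n) -> small_tails u.
Proof.
move=> /andP[t0 t1] ut e e0.
pose D := `|C| / (1 - t) + 1.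
have D0 : 0 < D by rewrite ltr_wpDl // divr_ge0 // subr_ge0 ltW.
have t_lt1 : `|t| < 1 by rewrite ger0_norm.
have [N _ HN] : \forall n \near \oo, `|t ^+ n| < e / D.
  by apply: cvgr0_norm_lt; [exact: cvg_expr | exact: divr_gt0].
(* The successor keeps all indices at least 1, where the geometric bound is assumed. *)
exists N.+1 => m n Nm.
have [nm|mn] := leqP n m; first by rewrite big_geq // ltW.
apply: (@le_trans _ _ (\sum_(m <= k < n) `|C| * t ^+ k)).
  apply: ler_sum_nat => k /andP[mk _].
  apply: (le_trans (ut k (leq_trans (ltn0Sn N) (leq_trans Nm mk)))).
  by rewrite ler_wpM2r ?exprn_ge0 // ler_norm.
rewrite -mulr_sumr.
have S1 : (1 - t) * \sum_(m <= k < n) t ^+ k <= t ^+ m.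
  rewrite mulr_sumr (@eq_bigr _ _ _ _ _ _ _ (fun k => - (t ^+ k.+1 - t ^+ k))).
    by rewrite sumrN telescope_sumr ?(ltnW mn) // opprB lerBlDr lerDl exprn_ge0.
  by move=> k _; rewrite exprS; ring.
have tm : t ^+ m <= e / D.
  have /ltW := HN m (ltnW Nm); rewrite ger0_norm ?exprn_ge0 //.
have t10 : 0 < 1 - t by rewrite subr_gt0.
apply: (@le_trans _ _ (`|C| * (t ^+ m / (1 - t)))).
  by rewrite ler_wpM2l // ler_pdivlMr // mulrC.
rewrite mulrCA.
apply: (@le_trans _ _ (e / D * D)); last by rewrite divfK ?gt_eqF.
by rewrite ler_pM ?exprn_ge0 ?divr_ge0 // ?ltW // /D ltrDl.
Qed.

Lemma analytic_small_tails c r d : analytic_series c -> 0 < r < 1 ->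
  small_tails (fun n => cmod (c n) * (n + d)%:R * r ^+ n.-1).
Proof.
move=> c_an r01; have [C [t t01 H]] := analytic_coef_geometric d c_an r01.
exact: small_tails_geometric t01 H.
Qed.

End power_series_tails.

(** * The expansion of a polyharmonic mapping *)

Section complex_sequences.
Context {R : realType}.
Implicit Types (u v : nat -> R[i]) (x y c : R[i]).

Lemma cvgC_conj u x : u n @[n --> \oo] --> x ->
  conjc (u n) @[n --> \oo] --> conjc x.
Proof.
move=> /cvg_cmodP ux; apply/cvg_cmodP => e /ux[N HN]; exists N => n Nn.
by rewrite -rmorphB cmod_conj HN.
Qed.

Lemma cvgC_D u v x y : u n @[n --> \oo] --> x -> v n @[n --> \oo] --> y ->
  (u n + v n) @[n --> \oo] --> x + y.
Proof.
move=> /cvg_cmodP ux /cvg_cmodP vy; apply/cvg_cmodP => e e0.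
have e20 : 0 < e / 2 by rewrite divr_gt0.
have [N HN] := ux _ e20; have [N' HN'] := vy _ e20.
exists (maxn N N') => n; rewrite geq_max => /andP[Nn N'n].
rewrite (_ : _ - _ = (u n - x) + (v n - y)); last by ring.
by rewrite (le_lt_trans (cmodD _ _)) // [ltRHS]splitr ltrD ?HN ?HN'.
Qed.

Lemma cvgC_cst c : c @[n --> \oo] --> c.
Proof. by apply/cvg_cmodP => e e0; exists 0%N => n _; rewrite subrr cmod0. Qed.

Lemma cvgC_Ml c u x : u n @[n --> \oo] --> x -> c * u n @[n --> \oo] --> c * x.
Proof.
move=> /cvg_cmodP ux; apply/cvg_cmodP => e e0.
have c0 : 0 < cmod c + 1 by rewrite ltr_wpDl ?cmod_ge0.
have [N HN] := ux _ (divr_gt0 e0 c0); exists N => n Nn.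
rewrite -mulrBr cmodM.
have := HN n Nn; rewrite ltr_pdivlMr //.
by have := cmod_ge0 (u n - x); nra.
Qed.

Lemma cvgC_B u v x y : u n @[n --> \oo] --> x -> v n @[n --> \oo] --> y ->
  (u n - v n) @[n --> \oo] --> x - y.
Proof.
move=> ux /(cvgC_Ml (c := -1)) vy; rewrite -mulN1r.
by under eq_fun do rewrite -mulN1r; exact: (cvgC_D ux vy).
Qed.

Lemma cvgC_sum (I : Type) (s : seq I) (u : I -> nat -> R[i]) (x : I -> R[i]) :
  (forall i, u i n @[n --> \oo] --> x i) ->
  (\sum_(i <- s) u i n) @[n --> \oo] --> \sum_(i <- s) x i.
Proof.
move=> ux; elim: s => [|i s IHs].
  by under eq_fun do rewrite big_nil; rewrite big_nil; exact: cvgC_cst.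
by under eq_fun do rewrite big_cons; rewrite big_cons; exact: (cvgC_D (ux i) IHs).
Qed.

Lemma cvgC_limn u x : u n @[n --> \oo] --> x -> limn u = x.
Proof. by move=> ux; apply: cvg_lim ux; exact: norm_hausdorff. Qed.

Lemma cvg_harmonic_series (c d : nat -> R[i]) z :
  analytic_series c -> analytic_series d -> disk z ->
  (\sum_(1 <= n < N) (c n * z ^+ n + conjc (d n * z ^+ n))) @[N --> \oo]
    --> harmonic_series c d z.
Proof.
move=> c_an d_an zD.
have /cvg_ex[x cx] := c_an _ zD; have /cvg_ex[y dy] := d_an _ zD.
have H := cvgC_D cx (cvgC_conj dy).
rewrite /harmonic_series; set u := fun N => _.
suff ux : u n @[n --> \oo] --> x + conjc y by rewrite (cvgC_limn ux).
by apply: cvg_trans H; under [in X in _ --> X]eq_fun do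
  rewrite rmorph_sum -big_split /=.
Qed.

End complex_sequences.

(** * Partial sums of the expansion and their derivatives *)

Section harmonic_expansion.
Context {R : realType}.
Variables (p : nat) (a b : nat -> nat -> R[i]).
Implicit Types (z w : R[i]) (r e : R).

(** The term [|z|^(2(k-1)) (a z^n + conj(b z^n))] written in monomials in [z] and [zbar]. *)
Definition hterm n k z : R[i] :=
  a n k * mono (n + (k - 1)) (k - 1) z +
  conjc (b n k) * mono (k - 1) (n + (k - 1)) z.

Definition hterm_dz n k z : R[i] :=
  a n k * mono_dz (n + (k - 1)) (k - 1) z +
  conjc (b n k) * mono_dz (k - 1) (n + (k - 1)) z.

Definition hterm_dzbar n k z : R[i] :=
  a n k * mono_dzbar (n + (k - 1)) (k - 1) z +
  conjc (b n k) * mono_dzbar (k - 1) (n + (k - 1)) z.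

Definition psum (f : nat -> nat -> R[i] -> R[i]) m z : R[i] :=
  \sum_(1 <= n < m) \sum_(1 <= k < p.+1) f n k z.

Lemma wirtinger_approx_psum m z e : 0 < e -> cmod z < 1 ->
  wirtinger_approx (psum hterm m) z (psum hterm_dz m z) (psum hterm_dzbar m z) e.
Proof.
move=> e0 z1; rewrite /psum.
have H n : forall e, 0 < e -> wirtinger_approx
    (fun w => \sum_(1 <= k < p.+1) hterm n k w) z
    (\sum_(1 <= k < p.+1) hterm_dz n k z)
    (\sum_(1 <= k < p.+1) hterm_dzbar n k z) e.
  apply: wirtinger_approx_sum => k d d0; rewrite [d]splitr.
  by apply: wirtinger_approxD; apply: wirtinger_approx_mono => //;
    rewrite divr_gt0.
exact: (wirtinger_approx_sum _ H).
Qed.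

Hypothesis a_analytic : forall k : nat, (1 <= k <= p)%N ->
  analytic_series (fun n => a n k).
Hypothesis b_analytic : forall k : nat, (1 <= k <= p)%N ->
  analytic_series (fun n => b n k).

Lemma cvg_psum_hterm z : disk z -> psum hterm N z @[N --> \oo] -->
  \sum_(1 <= k < p.+1) `|z| ^+ (2 * (k - 1)) *
    harmonic_series (fun n => a n k) (fun n => b n k) z.
Proof.
move=> zD.
have -> : (fun N => psum hterm N z) = (fun N => \sum_(1 <= k < p.+1)
    `|z| ^+ (2 * (k - 1)) *
      \sum_(1 <= n < N) (a n k * z ^+ n + conjc (b n k * z ^+ n))).
  apply/funext => N; rewrite /psum exchange_big; apply: eq_bigr => k _.
  rewrite mulr_sumr; apply: eq_bigr => n _.
  rewrite exprM sqr_normc /hterm /mono rmorphM rmorphXn !exprMn !exprD; ring.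
(* The range of [k] is repeated as a guard, so that it is available when [cvgC_sum] asks for
   convergence at every [k]. *)
have E (f : nat -> R[i]) :
    \sum_(1 <= k < p.+1) f k = \sum_(1 <= k < p.+1 | (1 <= k <= p)%N) f k.
  by rewrite [LHS]big_nat.
have -> : (fun N => \sum_(1 <= k < p.+1)
    `|z| ^+ (2 * (k - 1)) *
      \sum_(1 <= n < N) (a n k * z ^+ n + conjc (b n k * z ^+ n))) =
  (fun N => \sum_(1 <= k < p.+1) if (1 <= k <= p)%N then
    `|z| ^+ (2 * (k - 1)) *
      \sum_(1 <= n < N) (a n k * z ^+ n + conjc (b n k * z ^+ n)) else 0).
  by apply/funext => N; rewrite E big_mkcond.
rewrite [X in _ --> X]E big_mkcond; apply: cvgC_sum => k.
case: ifP => [kp|_]; last exact: cvgC_cst.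
by apply/cvgC_Ml/cvg_harmonic_series; [exact: a_analytic| exact: b_analytic|].
Qed.

(** Both monomials have degree [n + 2(k-1)], at most [n + 2p] and at least [n]; since [r <= 1], the
    power of [r] may be lowered to [n - 1]. *)
Lemma hterm_lip n k r z w : 0 < r <= 1 -> cmod z <= r -> cmod w <= r ->
  (1 <= n)%N -> (k <= p)%N ->
  cmod (hterm n k w - hterm n k z) <=
    (cmod (a n k) * (n + p.*2)%:R * r ^+ n.-1 +
     cmod (b n k) * (n + p.*2)%:R * r ^+ n.-1) * cmod (w - z).
Proof.
move=> /andP[r0 r1] zr wr n1 kp.
set h := cmod (w - z).
have lip s t : (s + t = n + (k - 1).*2)%N ->
    cmod (mono s t w - mono s t z) <= (n + p.*2)%:R * r ^+ n.-1 * h.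
  move=> st; apply: (le_trans (cmod_mono_lip s t zr wr)).
  rewrite st; apply: ler_wpM2r; first exact: cmod_ge0.
  apply: ler_pM; rewrite ?exprn_ge0 ?(ltW r0) //.
    by rewrite ler_nat leq_add2l leq_double (leq_trans (leq_subr _ _)).
  apply: ler_wiXn2l => //; first exact: ltW.
  by rewrite -!subn1 leq_sub2r // leq_addr.
have -> : hterm n k w - hterm n k z =
    a n k * (mono (n + (k - 1)) (k - 1) w - mono (n + (k - 1)) (k - 1) z) +
    conjc (b n k) *
      (mono (k - 1) (n + (k - 1)) w - mono (k - 1) (n + (k - 1)) z).
  by rewrite /hterm; ring.
apply: (le_trans (cmodD _ _)); rewrite !cmodM cmod_conj mulrDl -!mulrA.
rewrite (mulrA _%:R); apply: lerD; rewrite ler_wpM2l ?cmod_ge0 // lip //.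
  by rewrite -addnA addnn.
by rewrite addnCA addnn.
Qed.

(* Tails of the expansion have a small Lipschitz constant: since [F] is known to
   be differentiable, this replaces the termwise differentiation of series. *)
Lemma psum_tail_lip r e : 0 < r < 1 -> 0 < e -> exists N, forall m n z w,
  (N <= m)%N -> (m <= n)%N -> cmod z <= r -> cmod w <= r ->
  cmod ((psum hterm n w - psum hterm m w) - (psum hterm n z - psum hterm m z))
    <= e * cmod (w - z).
Proof.
move=> r01 e0; pose B n k := cmod (a n k) * (n + p.*2)%:R * r ^+ n.-1 +
     cmod (b n k) * (n + p.*2)%:R * r ^+ n.-1.
have : small_tails (fun n => \sum_(k <- index_iota 1 p.+1) B n k).
  apply: (small_tails_sum (u := fun k n => B n k)) => k.
  rewrite mem_index_iota ltnS => kp.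
  apply: small_tailsD; apply: analytic_small_tails => //.
    exact: a_analytic.
  exact: b_analytic.
move=> /(_ e e0)[N HN]; exists N.+1 => m n z w Nm mn zr wr.
have m1 : (1 <= m)%N by rewrite (leq_trans _ Nm).
have E x : psum hterm n x - psum hterm m x =
    \sum_(m <= l < n) \sum_(1 <= k < p.+1) hterm l k x.
  by rewrite /psum (@big_cat_nat _ _ _ m 1 n) //=; ring.
rewrite !E -sumrB.
apply: (@le_trans _ _ ((\sum_(m <= l < n) \sum_(1 <= k < p.+1) B l k) *
                       cmod (w - z))); last first.
  by rewrite ler_wpM2r ?cmod_ge0 ?HN // ltnW.
rewrite mulr_suml; apply: (le_trans (cmod_sum _ _ _)).
apply: ler_sum_nat => l /andP[ml _].
rewrite -sumrB mulr_suml; apply: (le_trans (cmod_sum _ _ _)).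
apply: ler_sum_nat => k /andP[k1 kp].
apply: hterm_lip => //; last by rewrite (leq_trans m1).
by case/andP: r01 => -> /ltW ->.
Qed.

Variables (F : R[i] -> R[i]) (a0 : R[i]).
Hypothesis F_form : forall z : R[i], disk z ->
  F z = a0 + \sum_(1 <= k < p.+1)
    `|z| ^+ (2 * (k - 1)) *
      harmonic_series (fun n => a n k) (fun n => b n k) z.

(** A partial sum is differentiable and the rest has Lipschitz constant [e / 2]. The index [N]
    depends on [r] and [e] only, so it serves the whole circle at once. *)
Lemma wirtinger_approx_expansion r e : 0 <= r < 1 -> 0 < e ->
  exists N, forall m z, (N <= m)%N -> cmod z <= r ->
    wirtinger_approx F z (psum hterm_dz m z) (psum hterm_dzbar m z) e.
Proof.
move=> /andP[r0 r1] e0.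
have e20 : 0 < e / 2 by rewrite divr_gt0.
(* The midpoint of [r] and 1 leaves room for the points [w] around a [z] with [|z| = r]. *)
pose s := (r + 1) / 2.
have s01 : 0 < s < 1 by rewrite /s; apply/andP; split; lra.
have rs : r < s by rewrite /s; lra.
have [N HN] := psum_tail_lip s01 e20; exists N => m z Nm zr.
have z1 : cmod z < 1 by rewrite (le_lt_trans zr).
have [d d0 Hd] := wirtinger_approx_psum m e20 z1.
exists (Num.min d (s - r)) => [|w]; first by rewrite lt_min d0 subr_gt0.
rewrite lt_min => /andP[wd ws].
have ws' : cmod w <= s.
  have -> : w = z + (w - z) by ring.
  by apply: (le_trans (cmodD _ _)); lra.
have zs : cmod z <= s by rewrite (le_trans zr) // ltW.
have s1 : s < 1 by case/andP: s01.
have zD : disk z by [].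
have wD : disk w by rewrite /disk /mkset (le_lt_trans ws').
pose P x := psum hterm m x.
(* The Lipschitz bound between the partial sums of orders [m] and [n] survives the limit in [n]. *)
have tail : cmod ((F w - a0 - P w) - (F z - a0 - P z)) <= e / 2 * cmod (w - z).
  apply: (cmod_lim_le (u := fun n => (psum hterm n w - P w) -
                                     (psum hterm n z - P z))); last first.
    by exists m => n mn; exact: HN.
  have cw := cvg_psum_hterm wD; have cz := cvg_psum_hterm zD.
  have FE x : disk x -> F x - a0 = \sum_(1 <= k < p.+1)
      `|x| ^+ (2 * (k - 1)) *
      harmonic_series (fun n => a n k) (fun n => b n k) x.
    by move=> /F_form ->; rewrite addrC addKr.
  rewrite (FE _ wD) (FE _ zD).
  exact: (cvgC_B (cvgC_B cw (cvgC_cst (c := P w)))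
    (cvgC_B cz (cvgC_cst (c := P z)))).
rewrite (_ : F w - F z - _ = (F w - a0 - P w - (F z - a0 - P z)) +
  (P w - P z - (psum hterm_dz m z * (w - z) +
     psum hterm_dzbar m z * conjc (w - z)))); last by ring.
apply: (le_trans (cmodD _ _)).
by rewrite [e]splitr mulrDl lerD // Hd.
Qed.

End harmonic_expansion.

(** * Coefficient estimates *)

Section coefficient_sums.
Context {R : realType}.
Implicit Types (x y z : R[i]) (w : nat -> R).

Lemma Arg_le_pihalf_Re z : `|Arg z| <= pi / 2 -> 0 <= complex.Re z.
Proof.
have [-> //|z0] := eqVneq z 0.
have nz0 : 0 < cmod z by rewrite lt_def cmod_eq0 z0 cmod_ge0.
have q1 : -1 <= complex.Re z / cmod z <= 1.
  rewrite -ler_norml normrM normfV (ger0_norm (cmod_ge0 z)).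
  by rewrite ler_pdivrMr // mul1r Re_le_cmod.
have -> : `|Arg z| = acos (complex.Re z / cmod z).
  by rewrite /Arg; case: ifP; rewrite ?normrN ger0_norm // acos_ge0.
move=> acos_le; have := @cos_ge0_pihalf R (acos (complex.Re z / cmod z)).
rewrite acosK ?in_itv // acos_le andbT.
have pi2 : 0 <= pi / 2 :> R by rewrite divr_ge0 ?pi_ge0.
rewrite (le_trans _ (acos_ge0 q1)) ?oppr_le0 // => /(_ isT).
by rewrite pmulr_lge0 // invr_gt0.
Qed.

(** As [x conj(y) = (x / y) |y|^2], its real part has the sign of that of the quotient. *)
Lemma Arg_div_le_Re_mulcJ x y : (x != 0 -> y != 0 -> `|Arg (x / y)| <= pi / 2) ->
  0 <= complex.Re (x * conjc y).
Proof.
have [->|x0] := eqVneq x 0; first by rewrite !mul0r lexx.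
have [->|y0] := eqVneq y 0; first by rewrite conjc0 mulr0 lexx.
move=> /(_ isT isT) /Arg_le_pihalf_Re xy0.
have -> : x * conjc y = (x / y) * (cmod y ^+ 2)%:C.
  by rewrite -mulcJ mulrA divfK.
by case: (x / y) xy0 => u v /= u0; rewrite mulr0 subr0 mulr_ge0 ?exprn_ge0 ?cmod_ge0.
Qed.

Lemma sum_cmod_sqr_le (I : eqType) (s : seq I) (x : I -> R[i]) :
  {in s &, forall i j, 0 <= complex.Re (x i * conjc (x j))} ->
  \sum_(i <- s) cmod (x i) ^+ 2 <= cmod (\sum_(i <- s) x i) ^+ 2.
Proof.
elim: s => [_|i s IHs xs]; first by rewrite !big_nil cmod0 expr0n.
rewrite !big_cons cmod_sqrD -addrA lerD2l.
have {}IHs := IHs (fun j k js ks => xs j k (mem_behead (s := i :: s) js)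
  (mem_behead (s := i :: s) ks)).
apply: (le_trans IHs); rewrite lerDl mulr_ge0 // rmorph_sum mulr_sumr /=.
have {IHs} : forall j, j \in s -> 0 <= complex.Re (x i * conjc (x j)).
  by move=> j js; apply: xs; rewrite ?mem_head // in_cons js orbT.
elim: s {xs} => [|j s IHs] xs; first by rewrite big_nil.
rewrite big_cons; have := xs j (mem_head _ _).
have := IHs (fun k ks => xs k (mem_behead (s := j :: s) ks)).
by case: (_ * _) (\sum_(k <- s) _) => [u v] [u' v'] /=; lra.
Qed.

Definition wsum p w (c : nat -> R[i]) : R[i] :=
  \sum_(1 <= k < p.+1) (w k)%:C * c k.

Lemma wsum_cmod_ge p w (c : nat -> R[i]) : (forall k, 0 <= w k) ->
  (forall k l, (1 <= k <= p)%N -> (1 <= l <= p)%N -> c k != 0 -> c l != 0 ->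
     `|Arg (c k / c l)| <= pi / 2) ->
  \sum_(1 <= k < p.+1) w k ^+ 2 * cmod (c k) ^+ 2 <= cmod (wsum p w c) ^+ 2.
Proof.
move=> w0 c_arg.
rewrite /wsum; under eq_bigr => k do
  rewrite -exprMn -{1}(ger0_norm (w0 k)) -cmod_real -cmodM.
apply: sum_cmod_sqr_le => k l; rewrite !mem_index_iota !ltnS => kp lp.
have := Arg_div_le_Re_mulcJ (c_arg k l kp lp).
have -> : complex.Re ((w k)%:C * c k * conjc ((w l)%:C * c l)) =
    w k * w l * complex.Re (c k * conjc (c l)).
  by rewrite !Re_mulcJ; case: (c k) (c l) => u v [u' v'] /=; ring.
by move=> cc0; rewrite mulr_ge0 // mulr_ge0.
Qed.

Lemma ler_sum_term (I : eqType) (s : seq I) (f : I -> R) i :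
  (forall j, 0 <= f j) -> i \in s -> f i <= \sum_(j <- s) f j.
Proof.
move=> f0; elim: s => // j s IHs; rewrite in_cons big_cons => /predU1P[->|si].
  by rewrite lerDl sumr_ge0.
by rewrite (le_trans (IHs si)) // lerDr.
Qed.

Lemma ler_sum_two_terms (I : eqType) (s : seq I) (f : I -> R) i j :
  (forall k, 0 <= f k) -> i \in s -> j \in s -> i != j ->
  f i + f j <= \sum_(k <- s) f k.
Proof.
move=> f0; elim: s => // k s IHs; rewrite !in_cons big_cons.
move=> /predU1P[->|si] /predU1P[->|sj]; rewrite ?eqxx // => ij.
- by rewrite lerD2l ler_sum_term.
- by rewrite addrC lerD2l ler_sum_term.
- by rewrite (le_trans (IHs si sj ij)) // lerDr.
Qed.

(** This plays the part of the limit [r -> 1]: take [r = 1 - t] with [t] small and bound [r^q] below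
    by Bernoulli's inequality. *)
Lemma le_of_mul_expr (q : nat) (x y : R) : 0 <= x ->
  (forall r, 0 < r < 1 -> r ^+ q * x <= y) -> x <= y.
Proof.
move=> x0 xy; apply/ler_addgt0Pr => e e0.
(* With [t = e / D] this ensures both [t < 1] and [t q x <= e]. *)
pose D := q%:R * x + e + 1.
have qx0 : 0 <= q%:R * x by rewrite mulr_ge0.
have D0 : 0 < D by rewrite /D; lra.
pose t := e / D.
have t0 : 0 < t by rewrite divr_gt0.
have t1 : t < 1 by rewrite ltr_pdivrMr // /D; lra.
have r01 : 0 < 1 - t < 1 by apply/andP; split; lra.
have := xy _ r01.
have /(expr_bernoulli q) : -1 <= - t by lra.
move=> /(ler_wpM2r x0) H1 H2.
have tD : t * (q%:R * x) <= e.
  rewrite mulrAC ler_pdivrMr // ler_wpM2l ?(ltW e0) // /D; lra.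
lra.
Qed.

End coefficient_sums.

(** * Trigonometric expansion of the derivatives on a circle *)

Section coefficient_bound.
Context {R : realType}.
Variables (p : nat) (a b : nat -> nat -> R[i]).
Implicit Types (z : R[i]) (r : R).

(* Coefficients of [z f_z] on the circle of radius [r], where [z zbar = r ^ 2],
   as combinations of the [a n k] and [b n k] over [k]. *)
Definition dz_weight r n k : R := (n + (k - 1))%:R * r ^+ (2 * (k - 1)).
Definition dzbar_weight r k : R := (k - 1)%:R * r ^+ (2 * (k - 1)).

(** The factor [z] restores the power lost by differentiation. On the circle [z zbar] is the
    constant [r^2], so for fixed [n] the terms in [a] all reduce to multiples of [z^n] and those in
    [b] to multiples of [zbar^n]. *)
Lemma psum_dz_trig_poly r m z : cmod z = r ->
  z * psum p (hterm_dz a b) m z =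
  trig_poly m (fun n => wsum p (dz_weight r n) (a n))
              (fun n => wsum p (dzbar_weight r) (b n)) z.
Proof.
move=> zr; have zz : z * conjc z = (r ^+ 2)%:C by rewrite mulcJ zr.
rewrite /psum /trig_poly mulr_sumr; apply: eq_big_nat => n /andP[n1 _].
rewrite /wsum !mulr_suml rmorph_sum -big_split mulr_sumr /=.
apply: eq_bigr => k _; rewrite /hterm_dz /mono_dz /dz_weight /dzbar_weight.
set j := (k - 1)%N.
have wE (q : nat) : (q%:R * r ^+ (2 * j))%:C = q%:R * z ^+ j * conjc z ^+ j.
  by rewrite rmorphM rmorph_nat exprM rmorphXn /= -zz exprMn mulrA.
rewrite -(mulrA _ (b n k)) conj_realM !wE rmorphM rmorphXn mulrDr.
congr (_ + _).
  by case: n n1 => // n _; rewrite addSn /= exprD exprS; ring.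
(* For [j = 0] the truncated exponent is harmless, as its coefficient vanishes. *)
case: j {wE} => [|j]; first by rewrite !mulr0n !mul0r !mulr0.
by rewrite exprD [z ^+ j.+1]exprS /=; ring.
Qed.

(** Conjugation exchanges the roles of [a] and [b], so the formulas for [F_z] also serve for
    [F_zbar]. *)
Lemma psum_dzbar_conj m z :
  psum p (hterm_dzbar a b) m z = conjc (psum p (hterm_dz b a) m z).
Proof.
rewrite /psum rmorph_sum; apply: eq_bigr => n _ /=.
rewrite rmorph_sum; apply: eq_bigr => k _ /=.
rewrite /hterm_dz /hterm_dzbar /mono_dz /mono_dzbar.
rewrite conjcD !conjcM !conjcX !conjc_nat !conjcK; ring.
Qed.

(** Only the term [n = k = 1] has a derivative without a factor [z] or [zbar]. *)
Lemma psum_hterm_dz0 m : (1 <= p)%N -> (1 < m)%N ->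
  psum p (hterm_dz a b) m 0 = a 1%N 1%N.
Proof.
move=> p1 m1.
have E n k : (1 <= n)%N -> hterm_dz a b n k 0 =
    if (n == 1%N) && (k - 1 == 0)%N then a n k else 0.
  case: n => // n _; rewrite /hterm_dz /mono_dz conjc0 addSn /=.
  rewrite [0 ^+ _.+1]exprS !mul0r !mulr0 addr0 eqSS.
  case: (k - 1)%N => [|j]; last by rewrite [0 ^+ j.+1]exprS !mul0r !mulr0 andbF.
  rewrite addn0 andbT expr0 mulr1.
  by case: n => [|n]; rewrite ?exprS ?expr0 /= ?mul0r ?mulr0 ?mulr1.
rewrite /psum (@big_ltn _ _ _ 1 m) // (@big_ltn _ _ _ 1 p.+1) ?ltnS // E //=.
rewrite [X in _ + X + _]big1_seq.
  rewrite addr0 [X in _ + X]big1_seq ?addr0 // => n /andP[_].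
  rewrite mem_index_iota => /andP[n1 _]; rewrite big1_seq // => k _.
  by rewrite E ?(ltnW n1) // gtn_eqF.
move=> k /andP[_]; rewrite mem_index_iota => /andP[k1 _].
by rewrite E //= subn_eq0 leqNgt k1.
Qed.

End coefficient_bound.

(** * Weighted sums of squares of the coefficients *)

Section coefficient_mass.
Context {R : realType}.
Variables (p : nat) (a b : nat -> nat -> R[i]).
Implicit Types (z : R[i]) (r e : R).

(** For [a n k] the weight [(n+k-1)^2] comes from [F_z] and [(k-1)^2] from [F_zbar]; for [b n k] the
    two sources are exchanged. *)
Definition coef_mass n k : R := ((n + (k - 1))%:R ^+ 2 + (k - 1)%:R ^+ 2) *
  (cmod (a n k) ^+ 2 + cmod (b n k) ^+ 2).

Hypothesis a_analytic : forall k : nat, (1 <= k <= p)%N ->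
  analytic_series (fun n => a n k).
Hypothesis b_analytic : forall k : nat, (1 <= k <= p)%N ->
  analytic_series (fun n => b n k).
Variables (F : R[i] -> R[i]) (a0 : R[i]).
Hypothesis p_ge1 : (1 <= p)%N.
Hypothesis F_form : forall z : R[i], disk z ->
  F z = a0 + \sum_(1 <= k < p.+1)
    `|z| ^+ (2 * (k - 1)) *
      harmonic_series (fun n => a n k) (fun n => b n k) z.
Hypothesis F_polyharmonic : polyharmonic p F.

Lemma dz_expansion r e : 0 <= r < 1 -> 0 < e ->
  exists N, forall m z, (N <= m)%N -> cmod z <= r ->
    cmod (dz F z - psum p (hterm_dz a b) m z) <= e /\
    cmod (dzbar F z - conjc (psum p (hterm_dz b a) m z)) <= e.
Proof.
move=> r01 e0.
have [N HN] := wirtinger_approx_expansion a_analytic b_analytic F_form r01 e0.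
exists N => m z Nm zr; rewrite -psum_dzbar_conj.
have zD : disk z by rewrite /disk /mkset (le_lt_trans zr) //; case/andP: r01.
have [dh dv] := polyharmonic_derivableC p_ge1 F_polyharmonic zD.
exact: dz_dzbar_approx dh dv (HN m z Nm zr).
Qed.

(** At 0 the partial sums are exactly [a 1 1] and [conj(b 1 1)], within every [e] of the derivatives
    of [F]. *)
Lemma lambda_at0 : lambda_ F 0 = `| cmod (a 1%N 1%N) - cmod (b 1%N 1%N) |.
Proof.
have r01 : 0 <= (0 : R) < 1 by rewrite lexx ltr01.
have H e : 0 < e -> cmod (dz F 0 - a 1%N 1%N) <= e /\
    cmod (dzbar F 0 - conjc (b 1%N 1%N)) <= e.
  move=> e0; have [N HN] := dz_expansion r01 e0.
  have := HN (maxn N 2) 0 (leq_maxl _ _); rewrite cmod0 lexx => /(_ isT).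
  by rewrite !psum_hterm_dz0 ?leq_maxr.
have E x y : (forall e, 0 < e -> cmod (x - y) <= e) -> cmod x = cmod y.
  move=> xy; congr cmod; apply/eqP; rewrite -subr_eq0 -cmod_eq0 eq_le cmod_ge0.
  by rewrite andbT; apply/ler_addgt0Pr => e e0; rewrite add0r xy.
have -> : cmod (b 1%N 1%N) = cmod (dzbar F 0).
  by rewrite -cmod_conj; apply/esym/E => e /H[].
by have -> : cmod (a 1%N 1%N) = cmod (dz F 0) by apply/esym/E => e /H[].
Qed.

Hypothesis a_arg : forall n k1 k2 : nat, (1 <= n)%N ->
  (1 <= k1 <= p)%N -> (1 <= k2 <= p)%N ->
  a n k1 != 0 -> a n k2 != 0 -> `|Arg (a n k1 / a n k2)| <= pi / 2%:R.
Hypothesis b_arg : forall n k3 k4 : nat, (1 <= n)%N ->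
  (1 <= k3 <= p)%N -> (1 <= k4 <= p)%N ->
  b n k3 != 0 -> b n k4 != 0 -> `|Arg (b n k3 / b n k4)| <= pi / 2%:R.
Variables (S L : R).
Hypothesis Lambda_bound : forall z, disk z -> Lambda_ F z <= L.
Hypothesis S_bound : forall z, disk z ->
  cmod (dz F z) ^+ 2 + cmod (dzbar F z) ^+ 2 <= S.

Lemma coef_mass_ge0 n k : 0 <= coef_mass n k.
Proof. by rewrite mulr_ge0 ?addr_ge0 ?exprn_ge0 ?cmod_ge0. Qed.

Lemma coef_mass_le_wsum r n : 0 <= r -> (1 <= n)%N ->
  \sum_(1 <= k < p.+1) r ^+ (2 * (k - 1)) ^+ 2 * coef_mass n k <=
  (cmod (wsum p (dz_weight r n) (a n)) ^+ 2 +
   cmod (wsum p (dzbar_weight r) (b n)) ^+ 2) +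
  (cmod (wsum p (dz_weight r n) (b n)) ^+ 2 +
   cmod (wsum p (dzbar_weight r) (a n)) ^+ 2).
Proof.
move=> r0 n1.
have w0 k : 0 <= dz_weight r n k by rewrite mulr_ge0 ?exprn_ge0.
have v0 k : 0 <= dzbar_weight r k by rewrite mulr_ge0 ?exprn_ge0.
have aA k l := @a_arg n k l n1; have bA k l := @b_arg n k l n1.
apply: le_trans (lerD (lerD (wsum_cmod_ge w0 aA) (wsum_cmod_ge v0 bA))
                      (lerD (wsum_cmod_ge w0 bA) (wsum_cmod_ge v0 aA))).
rewrite -!big_split /= le_eqVlt; apply/orP; left; apply/eqP.
by apply: eq_bigr => k _; rewrite /coef_mass /dz_weight /dzbar_weight; ring.
Qed.

Lemma sum_coef_mass_le r m : 0 < r < 1 ->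
  \sum_(1 <= n < m) \sum_(1 <= k < p.+1)
    r ^+ (2 * n) * (r ^+ (2 * (k - 1)) ^+ 2 * coef_mass n k) <= S.
Proof.
move=> /andP[r0 r1]; apply/ler_addgt0Pr => eta eta0.
have D0 : disk (0 : R[i]) by rewrite /disk /mkset cmod0.
have L0 : 0 <= L.
  by rewrite (le_trans _ (Lambda_bound D0)) // addr_ge0 ?cmod_ge0.
(* Replacing the derivatives by partial sums costs at most [2 e L + 2 e^2]; as [e <= 1], this is at
   most [e (2 L + 2) <= eta]. *)
pose e := Num.min 1 (eta / (2 * L + 2)).
have L20 : 0 < 2 * L + 2 by lra.
have e0 : 0 < e by rewrite lt_min ltr01 divr_gt0.
have e1 : e <= 1 by rewrite ge_min lexx.
have eL : e * (2 * L + 2) <= eta by rewrite -ler_pdivlMr // ge_min lexx orbT.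
have r01 : 0 <= r < 1 by rewrite ltW.
have [N HN] := dz_expansion r01 e0.
(* The order is raised until the partial sums approximate the derivatives; the added terms are
   nonnegative. *)
pose m' := maxn m N.
have h0 n k : 0 <= r ^+ (2 * n) * (r ^+ (2 * (k - 1)) ^+ 2 * coef_mass n k).
  apply: mulr_ge0; first by rewrite exprn_ge0 // ltW.
  exact: mulr_ge0 (sqr_ge0 _) (coef_mass_ge0 _ _).
apply: (@le_trans _ _ (\sum_(1 <= n < m') \sum_(1 <= k < p.+1)
    r ^+ (2 * n) * (r ^+ (2 * (k - 1)) ^+ 2 * coef_mass n k))).
  have [m1|m1] := leqP m 1.
    rewrite [leLHS]big_geq //.
    by apply: sumr_ge0 => n _; apply: sumr_ge0 => k _; exact: h0.
  rewrite [leRHS](@big_cat_nat _ _ _ m) ?leq_maxl ?(ltnW m1) //= lerDl.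
  by apply: sumr_ge0 => n _; apply: sumr_ge0 => k _; exact: h0.
apply: le_trans (_ : \sum_(1 <= n < m') r ^+ (2 * n) *
  ((cmod (wsum p (dz_weight r n) (a n)) ^+ 2 +
    cmod (wsum p (dzbar_weight r) (b n)) ^+ 2) +
   (cmod (wsum p (dz_weight r n) (b n)) ^+ 2 +
    cmod (wsum p (dzbar_weight r) (a n)) ^+ 2)) <= S + eta).
  apply: ler_sum_nat => n /andP[n1 _]; rewrite -mulr_sumr.
  by rewrite ler_wpM2l ?exprn_ge0 ?coef_mass_le_wsum // ltW.
apply: (trig_poly_bessel
  (x := fun n => wsum p (dz_weight r n) (a n))
  (y := fun n => wsum p (dzbar_weight r) (b n))
  (x' := fun n => wsum p (dz_weight r n) (b n))
  (y' := fun n => wsum p (dzbar_weight r) (a n))) => z.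
rewrite (ger0_norm (ltW r0)) => zr.
rewrite -!(psum_dz_trig_poly _ _ _ _ zr) !cmodM !zr !exprMn.
have zD : disk z by rewrite /disk /mkset zr.
have zr' : cmod z <= r by rewrite zr.
have [Ha Hb] := HN m' z (leq_maxr _ _) zr'.
set A := psum _ _ _ _ in Ha *; set B := psum _ _ _ _ in Hb *.
have A_le : cmod A <= cmod (dz F z) + e.
  have -> : A = dz F z - (dz F z - A) by ring.
  by rewrite (le_trans (cmodB _ _)) // lerD2l.
have B_le : cmod B <= cmod (dzbar F z) + e.
  rewrite -(cmod_conj B).
  have -> : conjc B = dzbar F z - (dzbar F z - conjc B) by ring.
  by rewrite (le_trans (cmodB _ _)) // lerD2l.
have := Lambda_bound zD; have := S_bound zD; rewrite /Lambda_.
move: A_le B_le; have := cmod_ge0 (dz F z); have := cmod_ge0 (dzbar F z).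
have := cmod_ge0 A; have := cmod_ge0 B.
move: (cmod A) (cmod B) (cmod (dzbar F z)) (cmod (dz F z)) => A' B' x y.
move=> B0 A0 x0 y0 Ax By xyS xyL.
have A2 : A' ^+ 2 <= (y + e) ^+ 2 by rewrite lerXn2r ?nnegrE ?addr_ge0 ?(ltW e0).
have B2 : B' ^+ 2 <= (x + e) ^+ 2 by rewrite lerXn2r ?nnegrE ?addr_ge0 ?(ltW e0).
have eL' : e * (x + y) <= e * L by rewrite ler_wpM2l ?(ltW e0) // addrC.
have ee : e * e <= e * 1 by rewrite ler_wpM2l ?(ltW e0).
have AB : A' ^+ 2 + B' ^+ 2 <= S + eta by nra.
(* The common factor [r^2], due to the multiplication by [z], is at most 1. *)
rewrite -mulrDr (le_trans _ AB) // ler_piMl ?addr_ge0 ?exprn_ge0 //.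
by rewrite exprn_ile1 ?ltW.
Qed.

(** Keep only the terms [(1, 1)] and [(n, k)] of the sum. Their powers of [r] are both at least
    [r^(2n + 4k)], which tends to 1. *)
Lemma coef_mass_pair_le n k : (1 <= n)%N -> (1 <= k <= p)%N ->
  (n, k) != (1%N, 1%N) -> coef_mass 1 1 + coef_mass n k <= S.
Proof.
move=> n1 kp nk; have /andP[k1 _] := kp.
apply: (@le_of_mul_expr _ (2 * n + 4 * k)%N) => [|r r01].
  by rewrite addr_ge0 ?coef_mass_ge0.
have /andP[r0 r1] := r01.
apply: le_trans (sum_coef_mass_le n.+1 r01).
pose h n k := r ^+ (2 * n) * (r ^+ (2 * (k - 1)) ^+ 2 * coef_mass n k).
have h0 i j : 0 <= h i j.
  apply: mulr_ge0; first by rewrite exprn_ge0 // ltW.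
  exact: mulr_ge0 (sqr_ge0 _) (coef_mass_ge0 _ _).
have rh i j : (i <= n)%N -> (j <= k)%N ->
    r ^+ (2 * n + 4 * k) * coef_mass i j <= h i j.
  move=> jn jk; rewrite /h mulrA -exprM -exprD ler_wpM2r ?coef_mass_ge0 //.
  apply: ler_wiXn2l; rewrite ?(ltW r0) ?(ltW r1) //.
  apply: leq_add; first by rewrite leq_mul.
  by rewrite mulnAC leq_mul // (leq_trans (leq_subr _ _)).
rewrite mulrDr; apply: (le_trans (lerD (rh 1%N 1%N n1 k1) (rh n k _ _))) => //.
have kI : k \in index_iota 1 p.+1 by rewrite mem_index_iota ltnS.
have oneI : 1%N \in index_iota 1 p.+1 by rewrite mem_index_iota ltnS.
have rows0 i : 0 <= \sum_(1 <= j < p.+1) h i j by apply: sumr_ge0.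
have nI : n \in index_iota 1 n.+1 by rewrite mem_index_iota ltnS n1 leqnn.
have oneI' : 1%N \in index_iota 1 n.+1 by rewrite mem_index_iota ltnS.
(* For [n = 1] the two terms lie in the same inner sum, otherwise in two different ones. *)
have [n_eq|n_neq] := eqVneq n 1%N.
  have one_k : 1%N != k.
    by move: nk; rewrite n_eq xpair_eqE eqxx eq_sym.
  apply: le_trans (ler_sum_term rows0 nI).
  have -> : h 1%N 1%N = h n 1%N by rewrite n_eq.
  exact: (ler_sum_two_terms (h0 n)).
rewrite eq_sym in n_neq.
apply: le_trans (ler_sum_two_terms rows0 oneI' nI n_neq).
by rewrite lerD // ler_sum_term.
Qed.

End coefficient_mass.

(** * The three coefficient estimates *)

Theorem corollary2p2 (R : realType) (K lambda : R) (p : nat)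
    (F : R[i] -> R[i]) (a0 : R[i]) (a b : nat -> nat -> R[i])
    (K_ge1 : 1 <= K) (p_ge1 : (1 <= p)%N)
    (F_quasiregular : quasiregular K F)
    (F_polyharmonic : polyharmonic p F)
    (a_analytic : forall k : nat, (1 <= k <= p)%N ->
       analytic_series (fun n => a n k))
    (b_analytic : forall k : nat, (1 <= k <= p)%N ->
       analytic_series (fun n => b n k))
    (F_form : forall z : R[i], disk z ->
       F z = a0 + \sum_(1 <= k < p.+1)
         `|z| ^+ (2 * (k - 1)) *
           harmonic_series (fun n => a n k) (fun n => b n k) z)
    (a_arg : forall n k1 k2 : nat, (1 <= n)%N ->
       (1 <= k1 <= p)%N -> (1 <= k2 <= p)%N ->
       a n k1 != 0 -> a n k2 != 0 -> `|Arg (a n k1 / a n k2)| <= pi / 2%:R)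
    (b_arg : forall n k3 k4 : nat, (1 <= n)%N ->
       (1 <= k3 <= p)%N -> (1 <= k4 <= p)%N ->
       b n k3 != 0 -> b n k4 != 0 -> `|Arg (b n k3 / b n k4)| <= pi / 2%:R)
    (lambda_bound : forall z : R[i], disk z -> lambda_ F z <= lambda)
    (F0 : F 0 = 0) (lambda_F0 : lambda_ F 0 = 1) :
  let M := Num.sqrt ((K ^+ 2 + 1) * lambda ^+ 2 - 1) in
  [/\ forall n : nat, (2 <= n)%N ->
        cmod (a n 1%N) + cmod (b n 1%N) <= M / n%:R,
      forall n k : nat, (2 <= n)%N -> (2 <= k <= p)%N ->
        cmod (a n k) + cmod (b n k) <= M / Num.sqrt 10%:R &
      forall k : nat, (2 <= k <= p)%N ->
        cmod (a 1%N k) + cmod (b 1%N k) <= M / Num.sqrt 5%:R].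
Proof.
move=> M.
have K0 : 0 <= K by rewrite (le_trans ler01).
have D0 : disk (0 : R[i]) by rewrite /disk /mkset cmod0.
have lambda_ge0 : 0 <= lambda := le_trans (normr_ge0 _) (lambda_bound _ D0).
have Lambda_bound z : disk z -> Lambda_ F z <= K * lambda.
  move=> zD; apply: le_trans (ler_wpM2l K0 (lambda_bound _ zD)).
  exact: (quasiregular_Lambda_le K0 p_ge1 F_polyharmonic F_quasiregular zD).
pose S := (K ^+ 2 + 1) * lambda ^+ 2 / 2.
have S_bound z : disk z -> cmod (dz F z) ^+ 2 + cmod (dzbar F z) ^+ 2 <= S.
  move=> zD; have := Lambda_bound z zD; have := lambda_bound z zD.
  rewrite /Lambda_ /lambda_ => lam Lam.
  have lam2 : (cmod (dz F z) - cmod (dzbar F z)) ^+ 2 <= lambda ^+ 2.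
    by rewrite -[leLHS]real_normK ?num_real // lerXn2r ?nnegrE.
  have Lam2 : (cmod (dz F z) + cmod (dzbar F z)) ^+ 2 <= (K * lambda) ^+ 2.
    by rewrite lerXn2r ?nnegrE ?addr_ge0 ?cmod_ge0 ?mulr_ge0.
  rewrite /S ler_pdivlMr //; move: lam2 Lam2; rewrite exprMn.
  by rewrite !sqrrD !sqrrN; lra.
(* Expand [(|a 1 1| - |b 1 1|)^2 = 1], where the product of the moduli is nonnegative. *)
have mass11 : 1 <= coef_mass a b 1 1.
  rewrite /coef_mass subnn addn0 expr1n expr0n addr0 mul1r.
  have := lambda_at0 a_analytic b_analytic p_ge1 F_form F_polyharmonic.
  rewrite lambda_F0 => /esym ab1.
  have : (cmod (a 1%N 1%N) - cmod (b 1%N 1%N)) ^+ 2 = 1.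
    by rewrite -[LHS]real_normK ?num_real // ab1 expr1n.
  have := cmod_ge0 (a 1%N 1%N); have := cmod_ge0 (b 1%N 1%N).
  by nra.
(* Since [(x + y)^2 <= 2 (x^2 + y^2)], the square of [d (|a n k| + |b n k|)] is at most twice the
   mass of [(n, k)]. The 2 cancels the 1/2 in [S], and the mass of [(1, 1)] accounts for the [- 1]
   under the root. *)
have bound n k d : (1 <= n)%N -> (1 <= k <= p)%N -> (n, k) != (1%N, 1%N) ->
    0 < d -> d ^+ 2 <= (n + (k - 1))%:R ^+ 2 + (k - 1)%:R ^+ 2 ->
    cmod (a n k) + cmod (b n k) <= M / d.
  move=> n1 kp nk d0 dw; rewrite ler_pdivlMr //.
  have mass := coef_mass_pair_le a_analytic b_analytic p_ge1 F_form F_polyharmonic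
    a_arg b_arg Lambda_bound S_bound n1 kp nk.
  have ab0 : 0 <= cmod (a n k) + cmod (b n k) by rewrite addr_ge0 ?cmod_ge0.
  have q0 : 0 <= cmod (a n k) ^+ 2 + cmod (b n k) ^+ 2.
    by rewrite addr_ge0 ?sqr_ge0.
  rewrite -[leLHS]ger0_norm; last by rewrite mulr_ge0 // ltW.
  rewrite -sqrtr_sqr /M; apply: ler_wsqrtr.
  have dq := ler_wpM2r q0 dw.
  have : (cmod (a n k) + cmod (b n k)) ^+ 2 <=
      2 * (cmod (a n k) ^+ 2 + cmod (b n k) ^+ 2).
    by have := sqr_ge0 (cmod (a n k) - cmod (b n k)); nra.
  move=> /(ler_wpM2r (sqr_ge0 d)); rewrite -exprMn => /le_trans; apply.
  by move: mass; rewrite /S {2}/coef_mass; lra.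
split=> [n n2|n k n2 /andP[k2 kp]|k /andP[k2 kp]].
- apply: bound; rewrite ?p_ge1 ?(ltnW n2) ?ltr0n //.
  + by rewrite xpair_eqE eqxx andbT gtn_eqF.
  + exact: ltnW.
  + by rewrite subnn addn0 expr0n addr0.
- apply: bound; rewrite ?kp ?(ltnW n2) ?(ltnW k2) ?sqrtr_gt0 //.
    by rewrite xpair_eqE gtn_eqF.
  (* Here [n + k - 1 >= 3] and [k - 1 >= 1], whence [10 = 3^2 + 1^2]. *)
  rewrite sqr_sqrtr // -!natrX -natrD ler_nat.
  have : (3 ^ 2 <= (n + (k - 1)) ^ 2)%N.
    by rewrite leq_exp2r // (@leq_add 2 1) // subn_gt0.
  have : (1 ^ 2 <= (k - 1) ^ 2)%N by rewrite leq_exp2r // subn_gt0.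
  by move=> le1 le9; exact: leq_add le9 le1.
- apply: bound; rewrite ?kp ?(ltnW k2) ?sqrtr_gt0 //.
    by rewrite xpair_eqE andbC gtn_eqF.
  (* With [n = 1] the factors are at least 2 and 1, whence [5 = 2^2 + 1^2]. *)
  rewrite sqr_sqrtr // -!natrX -natrD ler_nat.
  have : (2 ^ 2 <= (1 + (k - 1)) ^ 2)%N by rewrite leq_exp2r // ltnS subn_gt0.
  have : (1 ^ 2 <= (k - 1) ^ 2)%N by rewrite leq_exp2r // subn_gt0.
  by move=> le1 le4; exact: leq_add le4 le1.
Qed.
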